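(* Let $n\ge 3$ and let $F$ be an infinite field of characteristic $\neq 2$. If $H$ is a group and $H\equiv \mathrm{T}_n(F)$, then $H/Z(H)\cong P\mathrm{T}_n(L)$ for some field $L\equiv F$.
   Context: $\equiv$ denotes elementary equivalence (language of groups for groups, language of rings for fields). $\mathrm{T}_n(F)$ is the group of invertible upper triangular $n\times n$ matrices over $F$, $Z(G)$ is the center of $G$, and $P\mathrm{T}_n(L)=\mathrm{T}_n(L)/Z(\mathrm{T}_n(L))$. *)

(* Defs.v *)
From HB Require Import structures.
From mathcomp Require Import all_boot all_algebra.
From mathcomp Require Import boolp classical_sets cardinality.

Set Implicit Arguments.
Unset Strict Implicit.
Unset Printing Implicit Defensive.

Import GRing.Theory.

(* First-order formulas with equality over a language without relation
   symbols; [term n] is the set of terms in the variables 0, ..., n-1, and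
   [formula term n] the set of formulas whose free variables are among these.
   Variables are de Bruijn indices: a quantifier binds variable 0 of its body
   and shifts the others. Sentences are the elements of [formula term 0]. *)
Inductive formula (term : nat -> Type) : nat -> Type :=
| Equal n of term n & term n : formula term n
| Not n of formula term n : formula term n
| And n of formula term n & formula term n : formula term n
| Or n of formula term n & formula term n : formula term n
| Implies n of formula term n & formula term n : formula term n
| Forall n of formula term n.+1 : formula term n
| Exists n of formula term n.+1 : formula term n.

Fixpoint holds (term : nat -> Type) (T : Type)
    (eval : forall n, n.-tuple T -> term n -> T)
    (n : nat) (phi : formula term n) : n.-tuple T -> Prop :=
  match phi with
  | Equal _ t u => fun e => eval _ e t = eval _ e u
  | Not _ p => fun e => ~ holds eval p e
  | And _ p q => fun e => holds eval p e /\ holds eval q e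
  | Or _ p q => fun e => holds eval p e \/ holds eval q e
  | Implies _ p q => fun e => holds eval p e -> holds eval q e
  | Forall _ p => fun e => forall x : T, holds eval p [tuple of x :: e]
  | Exists _ p => fun e => exists x : T, holds eval p [tuple of x :: e]
  end.

Inductive group_term (n : nat) : Type :=
| GVar of 'I_n
| GOne
| GInv of group_term n
| GMul of group_term n & group_term n.

Fixpoint group_eval (G : groupType) (n : nat) (e : n.-tuple G)
    (t : group_term n) : G :=
  match t with
  | GVar i => tnth e i
  | GOne => 1%g
  | GInv u => (group_eval e u)^-1%g
  | GMul u v => (group_eval e u * group_eval e v)%g
  end.

Definition group_elem_equiv (G H : groupType) : Prop :=
  forall phi : formula group_term 0,
    holds (@group_eval G) phi [tuple] <-> holds (@group_eval H) phi [tuple].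

(* The library's [GRing.term] is not used: it has inverses and constants from
   the ring as parameters. *)
Inductive ring_term (n : nat) : Type :=
| RVar of 'I_n
| RZero
| ROne
| ROpp of ring_term n
| RAdd of ring_term n & ring_term n
| RMul of ring_term n & ring_term n.

Fixpoint ring_eval (R : pzRingType) (n : nat) (e : n.-tuple R)
    (t : ring_term n) : R :=
  match t with
  | RVar i => tnth e i
  | RZero => 0%R
  | ROne => 1%R
  | ROpp u => (- ring_eval e u)%R
  | RAdd u v => (ring_eval e u + ring_eval e v)%R
  | RMul u v => (ring_eval e u * ring_eval e v)%R
  end.

Definition ring_elem_equiv (R S : pzRingType) : Prop :=
  forall phi : formula ring_term 0,
    holds (@ring_eval R) phi [tuple] <-> holds (@ring_eval S) phi [tuple].

Definition isomorphic (G H : groupType) : Prop :=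
  exists f : {multiplicative G -> H}, bijective f.

Section CentralQuotient.
Local Open Scope group_scope.
Local Open Scope quotient_scope.
Variable G : groupType.
Implicit Types x y z : G.

Definition center : set G := [set z | forall x, commute z x].

Definition eqmod_center : rel G := fun x y => `[< center (x^-1 * y) >].

Lemma eqmod_centerP x y :
  reflect (exists2 z, center z & y = x * z) (eqmod_center x y).
Proof.
apply: (iffP (asboolP _)) => [Zxy | [z Zz ->]]; last by rewrite mulKg.
by exists (x^-1 * y); rewrite ?mulVKg.
Qed.

Lemma eqmod_center_equiv : equiv_class_of eqmod_center.
Proof.
split=> [x | x y | y x z].
- by apply/eqmod_centerP; exists 1; rewrite ?mulg1 // => y; exact/commute_sym/commute1.
- by apply/eqmod_centerP/eqmod_centerP => -[z Zz ->]; exists z^-1;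
    rewrite ?mulgK // => u; apply/commute_sym/commuteV/commute_sym.
- move=> /eqmod_centerP[a Za ->] /eqmod_centerP[b Zb ->].
  apply/eqmod_centerP; exists (a * b); last by rewrite mulgA.
  by move=> u; apply/commute_sym/commuteM; apply/commute_sym.
Qed.

Canonical eqmod_center_equiv_rel := EquivRelPack eqmod_center_equiv.

Definition central_quotient := {eq_quot eqmod_center}.

HB.instance Definition _ := Choice.on central_quotient.
HB.instance Definition _ := EqQuotient.on central_quotient.

Definition cq_one : central_quotient := lift_cst central_quotient 1.
Definition cq_inv := lift_op1 central_quotient (fun x => x^-1).
Definition cq_mul := lift_op2 central_quotient (fun x y => x * y).

Canonical pi_cq_one := PiConst cq_one.

Lemma pi_cq_inv : {morph \pi : x / x^-1 >-> cq_inv x}.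
Proof.
move=> x; unlock cq_inv; apply/eqmodP/eqmod_centerP.
case: (piP central_quotient x) => y /eqmodP/eqmod_centerP[z Zz ->].
exists z^-1; first by move=> u; apply/commute_sym/commuteV/commute_sym.
by rewrite invgM; apply/commute_sym/commuteV; rewrite /commute Zz.
Qed.

Canonical pi_cq_inv_morph := PiMorph1 pi_cq_inv.

Lemma pi_cq_mul : {morph \pi : x y / x * y >-> cq_mul x y}.
Proof.
move=> x y; unlock cq_mul; apply/eqmodP/eqmod_centerP.
case: (piP central_quotient x) => x' /eqmodP/eqmod_centerP[z Zz ->].
case: (piP central_quotient y) => y' /eqmodP/eqmod_centerP[t Zt ->].
exists (z * t); last by rewrite -!mulgA (mulgA z) (Zz y) -mulgA.
by move=> u; apply/commute_sym/commuteM; apply/commute_sym.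
Qed.

Canonical pi_cq_mul_morph := PiMorph2 pi_cq_mul.

Lemma cq_mulA : associative cq_mul.
Proof. by elim/quotW=> x; elim/quotW=> y; elim/quotW=> z; rewrite !piE mulgA. Qed.

Lemma cq_mul1 : left_id cq_one cq_mul.
Proof. by elim/quotW=> x; rewrite !piE mul1g. Qed.

Lemma cq_mulr1 : right_id cq_one cq_mul.
Proof. by elim/quotW=> x; rewrite !piE mulg1. Qed.

Lemma cq_mulV : left_inverse cq_one cq_inv cq_mul.
Proof. by elim/quotW=> x; rewrite !piE mulVg. Qed.

Lemma cq_mulrV : right_inverse cq_one cq_inv cq_mul.
Proof. by elim/quotW=> x; rewrite !piE mulgV. Qed.

HB.instance Definition _ := isGroup.Build central_quotient
  cq_mulA cq_mul1 cq_mulr1 cq_mulV cq_mulrV.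

End CentralQuotient.

Section Triangular.
Local Open Scope ring_scope.
Variables (n : nat) (F : fieldType).
Implicit Types A B : 'M[F]_n.

(* [is_trig_mx] means lower triangular. *)
Definition upper_unitmx A := is_trig_mx A^T && (A \in unitmx).

Record utriang := UTriang { umx :> 'M[F]_n; umxP : upper_unitmx umx }.

HB.instance Definition _ := [isSub for umx].
HB.instance Definition _ := [Choice of utriang by <:].

Lemma upper_unitmxP A :
  reflect ((forall i j : 'I_n, (j < i)%N -> A i j = 0) /\ A \in unitmx)
          (upper_unitmx A).
Proof.
apply: (iffP andP) => -[] => [/is_trig_mxP Atrig | Atrig] uA; split=> //.
  by move=> i j /Atrig; rewrite mxE.
by apply/is_trig_mxP => i j /Atrig; rewrite mxE.
Qed.

Lemma upper_unitmx1 : upper_unitmx 1%:M.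
Proof.
by rewrite /upper_unitmx trmx1 scalar_mx_is_trig unitmx1.
Qed.

Lemma upper_unitmxM A B :
  upper_unitmx A -> upper_unitmx B -> upper_unitmx (A *m B).
Proof.
move=> /upper_unitmxP[tA uA] /upper_unitmxP[tB uB].
apply/upper_unitmxP; split=> [i j lt_ji |]; last by rewrite unitmx_mul uA.
rewrite mxE big1 // => k _; case: (ltnP k i) => [/tA -> | le_ik].
  by rewrite mul0r.
by rewrite tB ?mulr0 // (leq_trans lt_ji).
Qed.

Lemma upper_unitmxV A : upper_unitmx A -> upper_unitmx (invmx A).
Proof.
move=> uppA; have /upper_unitmxP[tA uA] := uppA.
have nzA i : A i i != 0.
  move: uA; rewrite unitmxE GRing.unitfE -det_tr det_trig; last by case/andP: uppA.
  by move=> /prodf_neq0/(_ i isT); rewrite mxE.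
apply/upper_unitmxP; split; last by rewrite unitmx_inv.
move=> i j; have [m] := ubnP j; elim: m => // m IHm in j *.
rewrite ltnS => le_jm lt_ji; apply: (mulIf (nzA j)); rewrite mul0r.
have := congr1 (fun M : 'M_n => M i j) (mulVmx uA).
rewrite mxE (bigD1 j) //= big1 => [|k neq_kj]; last first.
  case: (ltnP j k) => [/tA -> | le_kj]; first by rewrite mulr0.
  have lt_kj : (k < j)%N by rewrite ltn_neqAle (val_eqE k j) neq_kj.
  by rewrite IHm ?mul0r //; [apply: leq_trans le_jm | apply: ltn_trans lt_ji].
by rewrite addr0 => ->; rewrite mxE -val_eqE gtn_eqF.
Qed.

Definition utriang_one : utriang := UTriang upper_unitmx1.
Definition utriang_inv (A : utriang) : utriang :=
  UTriang (upper_unitmxV (umxP A)).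
Definition utriang_mul (A B : utriang) : utriang :=
  UTriang (upper_unitmxM (umxP A) (umxP B)).

Lemma utriang_mulA : associative utriang_mul.
Proof. by move=> A B C; apply/val_inj/mulmxA. Qed.

Lemma utriang_mul1 : left_id utriang_one utriang_mul.
Proof. by move=> A; apply/val_inj/mul1mx. Qed.

Lemma utriang_mulr1 : right_id utriang_one utriang_mul.
Proof. by move=> A; apply/val_inj/mulmx1. Qed.

Lemma utriang_mulV : left_inverse utriang_one utriang_inv utriang_mul.
Proof. by move=> A; apply/val_inj/mulVmx; case/andP: (umxP A). Qed.

Lemma utriang_mulrV : right_inverse utriang_one utriang_inv utriang_mul.
Proof. by move=> A; apply/val_inj/mulmxV; case/andP: (umxP A). Qed.

HB.instance Definition _ := isGroup.Build utriang
  utriang_mulA utriang_mul1 utriang_mulr1 utriang_mulV utriang_mulrV.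

End Triangular.

Definition putriang (n : nat) (F : fieldType) : groupType :=
  central_quotient (utriang n F).

(* Main.v *)
From HB Require Import structures.
Require Import Defs.
From mathcomp Require Import all_boot all_algebra.
From mathcomp Require Import boolp classical_sets cardinality.

Set Implicit Arguments.
Unset Strict Implicit.
Unset Printing Implicit Defensive.

Import GRing.Theory.

(** Put [m = n - 1]. Dividing a matrix of T_n(F) by its upper left entry brings
    it to the shape [[1, v], [0, M]] with [v] a row vector of length [m] and [M]
    in T_m(F), so modulo its center T_n(F) is a group of affine maps: the
    translations by row vectors, extended by the linear group T_m(F) acting on
    them by right multiplication. This structure can be read off the abstract
    group from [m + 1] parameters: a homothety [s = diag(t, 1, ..., 1)] with [t]
    different from 0 and 1, and the translations [es = e_1, ..., e_m] by the
    unit row vectors. Indeed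
    - the centralizer of [s] is the linear part, and the commutators [~ s, g]
      are exactly the translations;
    - the center of that centralizer acts on translations by all nonzero
      scalars, so the orbit of [e_m] under it, together with 1, is a copy of the
      field: addition is the group law, and the product of [x <> 1] and [y] is
      the conjugate of [y] by any [z] in this center which sends [e_m] to [x];
    - the centralizer acts linearly on the translations, as the full group of
      invertible upper triangular matrices in the basis [es], and only central
      elements act trivially.

    The predicate [frame s es] is the conjunction of the properties of the
    parameters that this reconstruction uses. Four facts then give the theorem.
    A frame is a first-order notion ([holds_framef]). A frame of an arbitrary
    group [G] yields a field [L = coefs good] and an isomorphism from [G / Z(G)]
    to PT_n(L) ([frame_isomorphic]). The group T_n(F) has a frame as soon as [F]
    has an element other than 0 and 1 ([std_frame]). Finally, every frame of
    T_n(F), not only the standard one, has a field isomorphic to [F]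
    ([utriang_coefs_isom]): two of the conditions force [e_m] to be a matrix
    which differs from the identity in its upper right corner only.

    The existence of a frame being expressed by a sentence, [H] has a frame, and
    [L] is its field. A ring sentence about the field of a frame translates into
    a group formula about the frame ([holds_ring_formulaf]), so for each ring
    sentence true in [F] the statement that it holds in the fields of all frames
    is a group sentence true in T_n(F), hence in [H]; thus [L] satisfies it. *)

(** * Formulas in the language of groups *)

Local Notation "p ==> q" := (Defs.Implies p q).
Local Notation "p &&& q" := (And p q) (at level 80, right associativity).

Section GroupFormulas.

Fixpoint term_lift k (t : group_term k) : group_term k.+1 :=
  match t with
  | GVar i => GVar (lift ord0 i)
  | GOne => GOne _
  | GInv u => GInv (term_lift u)
  | GMul u v => GMul (term_lift u) (term_lift v)
  end.

Definition var0 k : group_term k.+1 := GVar ord0.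

Lemma eval_lift (G : groupType) k (e : k.-tuple G) x t :
  group_eval [tuple of x :: e] (term_lift t) = group_eval e t.
Proof. by elim: t => //= [i | t -> | t -> u ->] //; rewrite tnthS. Qed.

Definition conj_term k (t u : group_term k) := GMul (GInv u) (GMul t u).

Definition comm_term k (t u : group_term k) := GMul (GInv t) (conj_term t u).

Definition truef k : formula group_term k := Equal (GOne k) (GOne k).

(** Finite conjunctions and blocks of quantifiers are needed because the number
    of parameters of a frame depends on the size of the matrices. *)
Definition conjf k (fs : seq (formula group_term k)) :=
  foldr (@And _ k) (truef k) fs.

Lemma holds_conjf (G : groupType) k m (e : k.-tuple G)
    (fs : nat -> formula group_term k) (P : nat -> Prop) :
    (forall i, (i < m)%N -> holds (@group_eval G) (fs i) e <-> P i) ->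
  holds (@group_eval G) (conjf (mkseq fs m)) e <->
  forall i, (i < m)%N -> P i.
Proof.
rewrite /mkseq => fsP.
suff: holds (@group_eval G) (conjf [seq fs i | i <- iota 0 m]) e <->
      forall i, i \in iota 0 m -> P i.
  by move=> ->; split=> H i; have := H i; rewrite mem_iota.
have: forall i, i \in iota 0 m -> holds (@group_eval G) (fs i) e <-> P i.
  by move=> i; rewrite mem_iota => /fsP.
elim: (iota 0 m) => /= [//|i r IHr H]; split.
  move=> [hi hr] j; rewrite inE => /predU1P[-> | rj].
    by apply/H; rewrite ?mem_head.
  by move: j rj; apply/IHr => // j rj; apply: H; rewrite inE rj orbT.
move=> HP; split; first by apply/H; [|apply: HP]; rewrite mem_head.
by apply/IHr => j rj; [apply: H | apply: HP]; rewrite inE rj orbT.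
Qed.

Fixpoint foralls m k : formula group_term (m + k) -> formula group_term k :=
  match m with
  | 0 => id
  | m'.+1 => fun f => @foralls m' k (Forall f)
  end.

(** The block is prepended to the valuation in its own order: in the body, the
    variable [i] denotes the [i]-th element of the block. *)
Lemma holds_foralls (G : groupType) m k f (e : k.-tuple G) :
  holds (@group_eval G) (@foralls m k f) e <->
  forall xs : m.-tuple G, holds (@group_eval G) f [tuple of xs ++ e].
Proof.
elim: m f => [|m IHm] f /=.
  split=> [H xs | /(_ [tuple])]; rewrite ?tuple0.
    by rewrite (_ : [tuple of _] = e) //; apply/val_inj.
  by rewrite (_ : [tuple of _] = e) //; apply/val_inj.
apply: (iff_trans (IHm _)) => /=; split=> H xs => [|x].
  case/tupleP: xs => x xs; have := H xs x.
  by congr (holds _ _ _); apply/val_inj.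
by have := H [tuple of x :: xs]; congr (holds _ _ _); apply/val_inj.
Qed.

Fixpoint term_lifts m k (t : group_term k) : group_term (m + k) :=
  if m is m'.+1 then term_lift (term_lifts m' t) else t.

Definition block_var m k (i : 'I_m) : group_term (m + k) := GVar (lshift k i).

Lemma eval_lifts (G : groupType) m k (xs : m.-tuple G) (e : k.-tuple G) t :
  group_eval [tuple of xs ++ e] (term_lifts m t) = group_eval e t.
Proof.
elim: m xs => [|m IHm] xs /=.
  by rewrite tuple0 (_ : [tuple of _] = e) //; apply/val_inj.
case/tupleP: xs => x xs.
have -> : [tuple of [tuple of x :: xs] ++ e] =
    [tuple of x :: [tuple of xs ++ e]] :> (m + k).+1.-tuple G by apply/val_inj.
by rewrite eval_lift IHm.
Qed.

Lemma eval_block_vars (G : groupType) m k (xs : m.-tuple G) (e : k.-tuple G) :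
  [seq group_eval [tuple of xs ++ e] (block_var k i) | i <- enum 'I_m] = xs.
Proof.
rewrite -[RHS]map_tnth_enum; apply: eq_map => i /=.
by rewrite (tnth_lshift xs e i).
Qed.

End GroupFormulas.

(** * Frames of a group *)

(** In the intended model the group is T_(m+1)(F), [s] is the diagonal matrix
    diag(t, 1, ..., 1), and [es] lists, from left to right, the matrices that
    differ from the identity by one entry 1 of the first row. *)
Section Frame.
Local Open Scope group_scope.
Variables (G : groupType) (s : G) (es : seq G).
Implicit Types b c g x y z : G.

Definition cent x := commute s x.

(** The model of [scal] is the group of all diag(a, d, ..., d), which acts on
    the translations by scalars. *)
Definition scal z := cent z /\ forall x, cent x -> commute z x.

Definition translation b := exists g, b = [~ s, g].

(** The last basis vector spans the only line stable under the upper triangular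
    matrices acting on rows; it is the 1 of the field, and the neutral element
    of the group is its 0. *)
Definition unitv : G := last 1 es.

Definition coef x := x = 1 \/ exists z, scal z /\ x = unitv ^ z.

(** The graph of the multiplication of the vector [b] by the coefficient [x]: a
    relation, since no canonical [z] can be named by a group term. *)
Definition scale x b y :=
  x = 1 /\ y = 1 \/ exists z, scal z /\ (x = unitv ^ z /\ y = b ^ z).

(** Only spans of final segments of [es] are used: these subspaces form the flag
    preserved by the upper triangular matrices acting on rows. *)
Fixpoint span (vs : seq G) b : Prop :=
  if vs is v :: vs' then
    exists x y c, scale x v y /\ (span vs' c /\ b = y * c)
  else b = 1.

Definition translation_frame : Prop :=
  (forall b c, translation b -> translation c -> translation (b * c)) /\
  (forall b, translation b -> translation b^-1) /\
  (forall b c, translation b -> translation c -> commute b c) /\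
  (forall g, exists c b, cent c /\ (translation b /\ g = c * b)) /\
  (forall b, translation b -> cent b -> b = 1).

(** The multiplication of the field is well defined by the third condition and
    distributes over its addition by the fourth. The last two conditions serve
    in T_n(F), where they lead to an isomorphism of the field with [F]. *)
Definition scalar_frame : Prop :=
  unitv <> 1 /\
  (forall x, coef x -> coef x^-1) /\
  (forall z b, scal z -> unitv ^ z = unitv -> translation b -> b ^ z = b) /\
  (forall x y b u v, translation b ->
    scale x b u -> scale y b v -> scale (x * y) b (u * v)) /\
  (forall g, coef (unitv ^ g)) /\
  (forall x y, unitv ^ [~ x, y] = unitv).

Definition basis_frame : Prop :=
  (forall i, (i < size es)%N -> translation (nth 1 es i)) /\
  (forall b, translation b -> span es b) /\
  (forall i, (i < size es)%N -> ~ span (drop i.+1 es) (nth 1 es i)).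

(** The centralizer of [s] acts on the translations by upper triangular
    matrices; all invertible ones occur, a sequence of images of the basis
    vectors being prescribed as in a triangular matrix with no zero on the
    diagonal; and the kernel of this action is central. *)
Definition flag_frame : Prop :=
  (forall i, (i < size es)%N -> forall c, cent c ->
    span (drop i es) (nth 1 es i ^ c)) /\
  (forall bs : seq G, size bs = size es ->
    (forall i, (i < size es)%N ->
       span (drop i es) (nth 1 bs i) /\ ~ span (drop i.+1 es) (nth 1 bs i)) ->
    exists c, cent c /\
      (forall i, (i < size es)%N -> nth 1 es i ^ c = nth 1 bs i)) /\
  (forall c, cent c ->
    (forall i, (i < size es)%N -> nth 1 es i ^ c = nth 1 es i) ->
    forall g, commute c g).

Definition frame : Prop :=
  translation_frame /\ scalar_frame /\ basis_frame /\ flag_frame.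

End Frame.

Arguments cent {G}.
Arguments scal {G}.
Arguments translation {G}.
Arguments unitv {G}.
Arguments coef {G}.
Arguments scale {G}.
Arguments span {G}.

Section FrameConditions.
Variables (G : groupType) (s : G) (es : seq G) (good : frame s es).

Definition frame_trM := proj1 (proj1 good).
Definition frame_trV := proj1 (proj2 (proj1 good)).
Definition frame_trC := proj1 (proj2 (proj2 (proj1 good))).
Definition frame_factor := proj1 (proj2 (proj2 (proj2 (proj1 good)))).
Definition frame_trI := proj2 (proj2 (proj2 (proj2 (proj1 good)))).

Let scalars := proj1 (proj2 good).
Definition frame_unitv_neq1 := proj1 scalars.
Definition frame_coefV := proj1 (proj2 scalars).
Definition frame_free := proj1 (proj2 (proj2 scalars)).
Definition frame_scaleD := proj1 (proj2 (proj2 (proj2 scalars))).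
Definition frame_unitvJ := proj1 (proj2 (proj2 (proj2 (proj2 scalars)))).
Definition frame_unitvR := proj2 (proj2 (proj2 (proj2 (proj2 scalars)))).

Let basis := proj1 (proj2 (proj2 good)).
Definition frame_tr := proj1 basis.
Definition frame_span := proj1 (proj2 basis).
Definition frame_indep := proj2 (proj2 basis).

Let flag := proj2 (proj2 (proj2 good)).
Definition frame_flag := proj1 flag.
Definition frame_full := proj1 (proj2 flag).
Definition frame_faithful := proj2 (proj2 flag).

End FrameConditions.

(** * Frames are first-order definable *)

Section FrameFormula.
Local Open Scope group_scope.

Implicit Type G : groupType.

Definition seq_lift k (ts : seq (group_term k)) := [seq term_lift t | t <- ts].

Lemma eval_seq_lift G k (e : k.-tuple G) x ts :
  [seq group_eval [tuple of x :: e] t | t <- seq_lift ts] =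
  [seq group_eval e t | t <- ts].
Proof. by rewrite -map_comp; apply: eq_map => t /=; rewrite eval_lift. Qed.

Lemma eval_last G k (e : k.-tuple G) ts :
  group_eval e (last (GOne k) ts) = last 1 [seq group_eval e t | t <- ts].
Proof. by rewrite (last_map (group_eval e) ts (GOne k)). Qed.

Lemma eval_nth G k (e : k.-tuple G) ts i :
  group_eval e (nth (GOne k) ts i) = nth 1 [seq group_eval e t | t <- ts] i.
Proof.
have [lt_i | le_i] := ltnP i (size ts); first by rewrite (nth_map (GOne k)).
by rewrite !nth_default ?size_map.
Qed.

Definition commf k (t u : group_term k) := Equal (GMul t u) (GMul u t).

Definition scalf k (s z : group_term k) :=
  commf s z &&&
  Forall (commf (term_lift s) (var0 k) ==> commf (term_lift z) (var0 k)).

Definition translationf k (s b : group_term k) :=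
  Exists (Equal (term_lift b) (comm_term (term_lift s) (var0 k))).

Definition conj_unitvf k (es : seq (group_term k)) z :=
  conj_term (last (GOne k) es) z.

Definition coeff k (s : group_term k) es x :=
  Or (Equal x (GOne k))
    (Exists (scalf (term_lift s) (var0 k) &&&
             Equal (term_lift x) (conj_unitvf (seq_lift es) (var0 k)))).

Definition scalef k (s : group_term k) es x b y :=
  Or (Equal x (GOne k) &&& Equal y (GOne k))
    (Exists (scalf (term_lift s) (var0 k) &&&
             Equal (term_lift x) (conj_unitvf (seq_lift es) (var0 k)) &&&
             Equal (term_lift y) (conj_term (term_lift b) (var0 k)))).

Definition var1 k : group_term k.+2 := term_lift (var0 k).
Definition var2 k : group_term k.+3 := term_lift (var1 k).
Definition var3 k : group_term k.+4 := term_lift (var2 k).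

(** The bound [m] is the length of [vs]: the recursion cannot follow the list
    [vs] itself, whose terms are lifted under the quantifiers. *)
Fixpoint spanf m k (s : group_term k) es vs b : formula group_term k :=
  if m is m'.+1 then
    let up t := term_lift (term_lift (term_lift t)) in
    let ups ts := seq_lift (seq_lift (seq_lift ts)) in
    Exists (Exists (Exists
      (scalef (up s) (ups es) (var2 k) (up (head (GOne k) vs)) (var1 k.+1) &&&
       spanf m' (up s) (ups es) (ups (behead vs)) (var0 k.+2) &&&
       Equal (up b) (GMul (var1 k.+1) (var0 k.+2)))))
  else Equal b (GOne k).

Lemma and_iff A B C D : (A <-> C) -> (B <-> D) -> (A /\ B) <-> (C /\ D).
Proof. by move=> -> ->. Qed.
Lemma or_iff A B C D : (A <-> C) -> (B <-> D) -> (A \/ B) <-> (C \/ D).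
Proof. by move=> -> ->. Qed.
Lemma imp_iff (A B C D : Prop) :
  (A <-> C) -> (B <-> D) -> (A -> B) <-> (C -> D).
Proof. by move=> -> ->. Qed.
Lemma not_iff (A C : Prop) : (A <-> C) -> ~ A <-> ~ C.
Proof. by move=> ->. Qed.
Lemma forall_iff (T : Type) (P Q : T -> Prop) :
  (forall x, P x <-> Q x) -> (forall x, P x) <-> (forall x, Q x).
Proof. by move=> PQ; split=> H x; apply/PQ. Qed.
Lemma exists_iff (T : Type) (P Q : T -> Prop) :
  (forall x, P x <-> Q x) -> (exists x, P x) <-> (exists x, Q x).
Proof. by move=> PQ; split=> -[x /PQ Hx]; exists x. Qed.

(** A formula and the predicate that it expresses are built with the same
    connectives in the same order, so they are compared one connective at a
    time, down to equations between terms. *)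
Ltac fo_step :=
  first [ apply: and_iff | apply: or_iff | apply: not_iff
        | apply: exists_iff => ? | apply: forall_iff => ? | apply: imp_iff ].
Ltac fo_leaf :=
  rewrite /= ?(eval_lift, eval_seq_lift, eval_last, eval_nth, tnthS, tnth0) //=.
Ltac fo := rewrite /=; repeat fo_step; fo_leaf.

Lemma holds_coeff G k (e : k.-tuple G) s es x :
  holds (@group_eval G) (coeff s es x) e <->
  coef (group_eval e s) [seq group_eval e t | t <- es] (group_eval e x).
Proof. by rewrite /coef /unitv; fo. Qed.

Lemma holds_scalef G k (e : k.-tuple G) s es x b y :
  holds (@group_eval G) (scalef s es x b y) e <->
  scale (group_eval e s) [seq group_eval e t | t <- es]
    (group_eval e x) (group_eval e b) (group_eval e y).
Proof. by rewrite /scale /unitv; fo. Qed.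

Lemma holds_spanf G k (e : k.-tuple G) s es vs b :
  holds (@group_eval G) (spanf (size vs) s es vs b) e <->
  span (group_eval e s) [seq group_eval e t | t <- es]
    [seq group_eval e t | t <- vs] (group_eval e b).
Proof.
have [m le_vs] : exists m, m = size vs by eexists.
rewrite -le_vs; elim: m => [|m IHm] in k e s es vs b le_vs *.
  by case: vs le_vs.
case: vs le_vs => //= v vs [szE]; do 3!(apply: exists_iff => ?).
apply: and_iff; first by rewrite /scale; fo.
apply: and_iff; last by fo_leaf.
apply: (iff_trans (IHm _ _ _ _ _ _ _)); first by rewrite !size_map.
by fo_leaf.
Qed.

Definition span_dropf k (s : group_term k) es i b :=
  spanf (size es - i) s es (drop i es) b.

Lemma holds_span_dropf G k (e : k.-tuple G) s es i b :
  holds (@group_eval G) (span_dropf s es i b) e <->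
  span (group_eval e s) [seq group_eval e t | t <- es]
    (drop i [seq group_eval e t | t <- es]) (group_eval e b).
Proof.
by rewrite /span_dropf -size_drop -map_drop; apply: holds_spanf.
Qed.

Definition lift2 k (t : group_term k) := term_lift (term_lift t).
Definition seq_lift2 k (ts : seq (group_term k)) := seq_lift (seq_lift ts).

Definition translation_framef k (s : group_term k) :=
  let s1 := term_lift s in let s2 := term_lift s1 in let s3 := term_lift s2 in
  let x := var0 k in let y0 := var0 k.+1 in let y1 := var1 k in
  Forall (Forall (translationf s2 y1 ==> (translationf s2 y0 ==>
                  translationf s2 (GMul y1 y0)))) &&&
  Forall (translationf s1 x ==> translationf s1 (GInv x)) &&&
  Forall (Forall (translationf s2 y1 ==> (translationf s2 y0 ==>
                  commf y1 y0))) &&&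
  Forall (Exists (Exists (commf s3 (var1 k.+1) &&&
    translationf s3 (var0 k.+2) &&&
    Equal (var2 k) (GMul (var1 k.+1) (var0 k.+2))))) &&&
  Forall (translationf s1 x ==> (commf s1 x ==> Equal x (GOne _))).

Definition scalar_framef k (s : group_term k) (es : seq (group_term k)) :=
  let s1 := term_lift s in let s2 := term_lift s1 in
  let es1 := seq_lift es in let es2 := seq_lift es1 in
  let s5 := term_lift (lift2 s2) in let es5 := seq_lift (seq_lift2 es2) in
  let x := var0 k in let y0 := var0 k.+1 in let y1 := var1 k in
  let x4 := term_lift (var3 k) in let x3 := var3 k.+1 in
  let x2 := var2 k.+2 in let x1 := var1 k.+3 in let x0 := var0 k.+4 in
  Not (Equal (last (GOne _) es) (GOne _)) &&&
  Forall (coeff s1 es1 x ==> coeff s1 es1 (GInv x)) &&&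
  Forall (Forall (scalf s2 y1 ==>
    (Equal (conj_unitvf es2 y1) (last (GOne _) es2) ==>
    (translationf s2 y0 ==> Equal (conj_term y0 y1) y0)))) &&&
  Forall (Forall (Forall (Forall (Forall (translationf s5 x2 ==>
    (scalef s5 es5 x4 x2 x1 ==> (scalef s5 es5 x3 x2 x0 ==>
     scalef s5 es5 (GMul x4 x3) x2 (GMul x1 x0)))))))) &&&
  Forall (coeff s1 es1 (conj_unitvf es1 x)) &&&
  Forall (Forall (Equal (conj_unitvf es2 (comm_term y1 y0))
                        (last (GOne _) es2))).

Definition basis_framef k (s : group_term k) (es : seq (group_term k)) :=
  let m := size es in
  let s1 := term_lift s in let es1 := seq_lift es in
  conjf (mkseq (fun i => translationf s (nth (GOne k) es i)) m) &&&
  Forall (translationf s1 (var0 k) ==> span_dropf s1 es1 0 (var0 k)) &&&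
  conjf (mkseq (fun i => Not (span_dropf s es i.+1 (nth (GOne k) es i))) m).

Definition flag_framef k (s : group_term k) (es : seq (group_term k)) :=
  let m := size es in
  let s1 := term_lift s in let es1 := seq_lift es in let x := var0 k in
  let bs := [seq block_var k i | i <- enum 'I_m] in
  let sb := term_lifts m s in let eb := [seq term_lifts m t | t <- es] in
  conjf (mkseq (fun i => Forall (commf s1 x ==>
    span_dropf s1 es1 i (conj_term (nth (GOne _) es1 i) x))) m) &&&
  foralls (
    conjf (mkseq (fun i => span_dropf sb eb i (nth (GOne _) bs i) &&&
      Not (span_dropf sb eb i.+1 (nth (GOne _) bs i))) m) ==>
    Exists (commf (term_lift sb) (var0 _) &&&
      conjf (mkseq (fun i => Equal
         (conj_term (nth (GOne _) (seq_lift eb) i) (var0 _))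
         (nth (GOne _) (seq_lift bs) i)) m))) &&&
  Forall (commf s1 x ==>
    (conjf (mkseq (fun i => Equal (conj_term (nth (GOne _) es1 i) x)
        (nth (GOne _) es1 i)) m) ==>
     Forall (commf (var1 k) (var0 _)))).

Definition framef k (s : group_term k) (es : seq (group_term k)) :=
  translation_framef s &&& scalar_framef s es &&&
  basis_framef s es &&& flag_framef s es.

Lemma eval_block_seq G m k (xs : m.-tuple G) (e : k.-tuple G) :
  [seq group_eval [tuple of xs ++ e] t |
     t <- [seq block_var k i | i <- enum 'I_m]] = xs.
Proof. by rewrite -map_comp; apply: eval_block_vars. Qed.

Lemma eval_seq_lifts G m k (xs : m.-tuple G) (e : k.-tuple G) ts :
  [seq group_eval [tuple of xs ++ e] t | t <- [seq term_lifts m t | t <- ts]] =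
  [seq group_eval e t | t <- ts].
Proof. by rewrite -map_comp; apply: eq_map => t /=; rewrite eval_lifts. Qed.

Lemma holds_translation_framef G k (e : k.-tuple G) s :
  holds (@group_eval G) (translation_framef s) e <->
  translation_frame (group_eval e s).
Proof. by rewrite /translation_frame; repeat apply: and_iff; fo. Qed.

Lemma holds_scalar_framef G k (e : k.-tuple G) s es :
  holds (@group_eval G) (scalar_framef s es) e <->
  scalar_frame (group_eval e s) [seq group_eval e t | t <- es].
Proof. by rewrite /scalar_frame; repeat apply: and_iff; fo. Qed.

Ltac fo_span := apply: (iff_trans (holds_span_dropf _ _ _ _ _)); fo_leaf.

Lemma holds_basis_framef G k (e : k.-tuple G) s es :
  holds (@group_eval G) (basis_framef s es) e <->
  basis_frame (group_eval e s) [seq group_eval e t | t <- es].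
Proof.
rewrite /basis_frame size_map /=; repeat apply: and_iff.
- by apply: holds_conjf => i _; fo.
- apply: forall_iff => x; apply: imp_iff; first by fo.
  by fo_span; rewrite drop0.
- by apply: holds_conjf => i _; apply: not_iff; fo_span.
Qed.

Lemma holds_flag_framef G k (e : k.-tuple G) s es :
  holds (@group_eval G) (flag_framef s es) e <->
  flag_frame (group_eval e s) [seq group_eval e t | t <- es].
Proof.
rewrite /flag_frame size_map /=; repeat apply: and_iff.
- apply: holds_conjf => i _; apply: forall_iff => c; apply: imp_iff.
    by fo.
  by fo_span.
- apply: (iff_trans (holds_foralls _ _)).
  have tupleE (P : seq G -> Prop) : (forall xs : (size es).-tuple G, P xs) <->
      (forall xs, size xs = size es -> P xs).
    split=> H xs; last by apply: H; rewrite size_tuple.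
    by move/eqP=> szxs; apply: (H (Tuple szxs)).
  rewrite -tupleE; apply: forall_iff => bs; apply: imp_iff.
    apply: holds_conjf => i _; apply: and_iff; last apply: not_iff.
      by fo_span; rewrite eval_lifts eval_seq_lifts eval_block_seq.
    by fo_span; rewrite eval_lifts eval_seq_lifts eval_block_seq.
  apply: exists_iff => c; apply: and_iff.
    by rewrite /= eval_lift eval_lifts.
  apply: holds_conjf => i _ /=.
  by rewrite !eval_nth !eval_seq_lift eval_seq_lifts eval_block_seq.
- apply: forall_iff => c; apply: imp_iff; first by fo.
  apply: imp_iff; last by fo.
  by apply: holds_conjf => i _; fo.
Qed.

Lemma holds_framef G k (e : k.-tuple G) s es :
  holds (@group_eval G) (framef s es) e <->
  frame (group_eval e s) [seq group_eval e t | t <- es].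
Proof.
apply: and_iff; first exact: holds_translation_framef.
apply: and_iff; first exact: holds_scalar_framef.
by apply: and_iff; [exact: holds_basis_framef | exact: holds_flag_framef].
Qed.

End FrameFormula.

(** * The field and the vector space of a frame *)

Section FrameTheory.
Local Open Scope group_scope.
Variables (G : groupType) (s : G) (es : seq G).
Implicit Types b c g x y z : G.

Lemma centM x y : cent s x -> cent s y -> cent s (x * y).
Proof. exact: commuteM. Qed.

Lemma centV x : cent s x -> cent s x^-1.
Proof. exact: commuteV. Qed.

Lemma scalM x y : scal s x -> scal s y -> scal s (x * y).
Proof.
move=> [cx zx] [cy zy]; split=> [|c cc]; first exact: centM.
by apply/commute_sym/commuteM; apply/commute_sym; [apply: zx | apply: zy].
Qed.

Lemma scal1 : scal s 1.
Proof. by split=> [|x _]; [apply: commute1 | apply/commute_sym/commute1]. Qed.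

Lemma scalV x : scal s x -> scal s x^-1.
Proof.
move=> [cx zx]; split=> [|c cc]; first exact: centV.
by apply/commute_sym/commuteV/commute_sym/zx.
Qed.

Lemma translationJ b c : cent s c -> translation s b -> translation s (b ^ c).
Proof.
move=> cc [g ->]; exists (g ^ c).
by rewrite conjRg (_ : s ^ c = s) //; apply/conjg_fixP/commgP.
Qed.

Hypothesis good : frame s es.

Let unitv_neq1 := frame_unitv_neq1 good.
Let scaleD := frame_scaleD good.

Local Notation f := (unitv es).

Lemma tr1 : translation s 1. Proof. by exists 1; rewrite commg1. Qed.

Lemma unitv_nth : f = nth 1 es (size es).-1.
Proof. exact: (esym (nth_last _ _)). Qed.

Lemma size_frame_gt0 : (0 < size es)%N.
Proof. by case: (es) unitv_neq1. Qed.

Lemma translation_unitv : translation s f.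
Proof.
by rewrite unitv_nth; apply: (frame_tr good); rewrite ltn_predL size_frame_gt0.
Qed.

Lemma translation_coef x : coef s es x -> translation s x.
Proof.
case=> [-> | [z [[cz _] ->]]]; first exact: tr1.
exact/translationJ/translation_unitv.
Qed.

Lemma coef_unitv : coef s es f.
Proof. by right; exists 1; rewrite conjg1; split=> //; exact: scal1. Qed.

Definition scal_of x : G := xget 1 [set z | scal s z /\ x = f ^ z].

Lemma scal_ofP x : coef s es x -> x <> 1 ->
  scal s (scal_of x) /\ x = f ^ scal_of x.
Proof.
by case=> // ex _; apply: (@xgetPex _ 1 [set z | scal s z /\ x = f ^ z] ex).
Qed.

(** If [z] and [z'] agree on [unitv], then [z * z'^-1] fixes [unitv], hence all
    translations. So the action of a scalar depends only on the coefficient to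
    which it sends [unitv]. *)
Lemma free_scal z z' b : scal s z -> scal s z' -> f ^ z = f ^ z' ->
  translation s b -> b ^ z = b ^ z'.
Proof.
move=> sz sz' fzz' trb.
rewrite -[LHS](conjgKV z') -(conjgM b) (frame_free good (z := z * z'^-1)) //.
  by apply: scalM => //; apply: scalV.
by rewrite conjgM fzz' conjgK.
Qed.

(** Scalar multiplication as a total function, obtained from the relation
    [scale] by choosing a scalar; by [smulE] the choice does not matter. *)
Definition smul x b : G := if x == 1 then 1 else b ^ scal_of x.

Lemma smul1g b : smul 1 b = 1. Proof. by rewrite /smul eqxx. Qed.

Lemma smulE x z b : translation s b -> scal s z -> x = f ^ z ->
  smul x b = b ^ z.
Proof.
move=> trb sz xE; have x1 : x <> 1.
  by move=> x1; apply: unitv_neq1; apply: (conjg_inj z); rewrite -xE conj1g.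
rewrite /smul; case: eqP => // _.
have [|sx xE'] := scal_ofP _ x1; first by right; exists z.
by apply: free_scal => //; rewrite -xE'.
Qed.

Lemma scale_smul x b : coef s es x -> scale s es x b (smul x b).
Proof.
move=> cx; rewrite /smul; case: eqP => [-> | x1]; first by left.
by right; exists (scal_of x); have [] := scal_ofP cx x1.
Qed.

Lemma scaleP x b y : translation s b ->
  scale s es x b y <-> coef s es x /\ y = smul x b.
Proof.
move=> trb; split=> [|[cx ->]]; last exact: scale_smul.
case=> [[-> ->] | [z [sz [xE ->]]]]; first by rewrite smul1g; split=> //; left.
by split; [right; exists z | rewrite (smulE _ sz)].
Qed.

Lemma smul_tr x b : coef s es x -> translation s b -> translation s (smul x b).
Proof.
case=> [-> | [z [sz xE]]] trb; first by rewrite smul1g; apply: tr1.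
by rewrite (smulE _ sz) //; apply: translationJ => //; case: sz.
Qed.

(** A coefficient is its own product with [unitv], so additivity of the scalar
    multiplication at [unitv] says that a sum of coefficients is a
    coefficient. *)
Lemma coefD x y : coef s es x -> coef s es y -> coef s es (x * y).
Proof.
move=> cx cy; have trf := translation_unitv.
have := scaleD trf (scale_smul f cx) (scale_smul f cy).
by rewrite scaleP // => -[].
Qed.

Lemma coefM x y : coef s es x -> coef s es y -> coef s es (smul x y).
Proof.
case=> [-> | [z [sz xE]]]; first by rewrite smul1g; left.
case=> [-> | [z' [sz' ->]]].
  by rewrite (smulE _ sz) // ?conj1g; [left | apply: tr1].
rewrite (smulE _ sz) // -?conjgM; last first.
  by apply: translationJ translation_unitv; case: sz'.
by right; exists (z' * z); split=> //; apply: scalM.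
Qed.

(** Both products are conjugates of [unitv] by a product of two elements of
    [scal], which is commutative. *)
Lemma smulC x y : coef s es x -> coef s es y -> smul x y = smul y x.
Proof.
case=> [-> | [z [sz xE]]] cy.
  rewrite smul1g; case: cy => [-> | [z [sz yE]]]; first by rewrite smul1g.
  by rewrite (smulE tr1 sz) // conj1g.
have trx : translation s x by apply: translation_coef; right; exists z.
case: cy => [-> | [z' [sz' yE]]].
  by rewrite (smulE tr1 sz) // conj1g smul1g.
have tr_y : translation s y by apply: translation_coef; right; exists z'.
rewrite (smulE tr_y sz) // (smulE trx sz') // xE yE -!conjgM; congr (_ ^ _).
by apply: (proj2 sz'); case: sz.
Qed.

Lemma smulA x y b : coef s es x -> coef s es y -> translation s b ->
  smul (smul x y) b = smul x (smul y b).
Proof.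
case=> [-> | [z [sz xE]]] cy trb; first by rewrite !smul1g.
have tr_y := translation_coef cy.
have trb' := smul_tr cy trb.
rewrite (smulE tr_y sz) // (smulE trb' sz) //.
case: cy => [-> | [z' [sz' yE]]]; first by rewrite conj1g !smul1g conj1g.
rewrite (smulE trb sz' yE) -conjgM.
by apply: smulE => //; [apply: scalM | rewrite yE conjgM].
Qed.

Lemma smulDl x y b : coef s es x -> coef s es y -> translation s b ->
  smul (x * y) b = smul x b * smul y b.
Proof.
move=> cx cy trb; have := scaleD trb (scale_smul b cx) (scale_smul b cy).
by rewrite scaleP // => -[].
Qed.

(** Conjugation is an automorphism. *)
Lemma smulDr x b c : smul x (b * c) = smul x b * smul x c.
Proof. by rewrite /smul; case: eqP => _; rewrite ?mulg1 // conjMg. Qed.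

Lemma unit_smul b : translation s b -> smul f b = b.
Proof. by move=> trb; rewrite (smulE trb scal1) conjg1. Qed.

Lemma smulJ x b c : coef s es x -> translation s b -> cent s c ->
  smul x b ^ c = smul x (b ^ c).
Proof.
move=> [-> | [z [sz xE]]] trb cc; first by rewrite !smul1g conj1g.
rewrite (smulE trb sz) // (smulE (translationJ cc trb) sz) // -!conjgM.
by congr (_ ^ _); apply: (proj2 sz).
Qed.

Definition sinv x : G := if x == 1 then 1 else f ^ (scal_of x)^-1.

Lemma coef_sinv x : coef s es x -> coef s es (sinv x).
Proof.
move=> cx; rewrite /sinv; case: eqP => [_ | x1]; first by left.
right; exists (scal_of x)^-1; split=> //.
by apply: scalV; case: (scal_ofP cx x1).
Qed.

Lemma sinvP x : coef s es x -> x <> 1 -> smul (sinv x) x = f.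
Proof.
move=> cx x1; have [sx xE] := scal_ofP cx x1.
rewrite (@smulE _ (scal_of x)^-1) //; first by rewrite {1}xE conjgK.
- exact: translation_coef.
- exact: scalV.
- by rewrite /sinv; case: eqP x1.
Qed.
End FrameTheory.

Section FrameField.
Local Open Scope group_scope.
Variables (G : groupType) (s : G) (es : seq G) (good : frame s es).
Implicit Types b c g x y z : G.

(** The types take the frame itself as a parameter, so that the algebraic
    structures below, which depend on its conditions, can be inferred. *)
Definition coefs of frame s es := {x : G | `[< coef s es x >]}.
Definition translations of frame s es := {b : G | `[< translation s b >]}.

Local Notation L := (coefs good).
Local Notation V := (translations good).

HB.instance Definition _ := Choice.copy L {x : G | `[< coef s es x >]}.
HB.instance Definition _ := Choice.copy V {b : G | `[< translation s b >]}.

Definition coefs_of x (cx : coef s es x) : L := exist _ x (asboolT cx).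
Definition translations_of b (tb : translation s b) : V :=
  exist _ b (asboolT tb).

Lemma coefsP (a : L) : coef s es (sval a).
Proof. by case: a => x /= /asboolP. Qed.
Lemma translationsP (v : V) : translation s (sval v).
Proof. by case: v => x /= /asboolP. Qed.

Lemma coefs_inj (a a' : L) : sval a = sval a' -> a = a'.
Proof. exact: val_inj. Qed.
Lemma translations_inj (v v' : V) : sval v = sval v' -> v = v'.
Proof. exact: val_inj. Qed.

Lemma coef1 : coef s es 1. Proof. by left. Qed.

Let trM := frame_trM good.
Let trV := frame_trV good.
Let trC := frame_trC good.
Let coefV := frame_coefV good.

Definition vzero : V := translations_of (tr1 s).
Definition vopp (v : V) : V := translations_of (trV (translationsP v)).
Definition vadd (v w : V) : V :=
  translations_of (trM (translationsP v) (translationsP w)).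

Lemma vaddA : associative vadd.
Proof. by move=> u v w; apply: translations_inj; apply: mulgA. Qed.
Lemma vaddC : commutative vadd.
Proof.
by move=> v w; apply: translations_inj; apply: trC; apply: translationsP.
Qed.
Lemma vadd0 : left_id vzero vadd.
Proof. by move=> v; apply: translations_inj; apply: mul1g. Qed.
Lemma vaddN : left_inverse vzero vopp vadd.
Proof. by move=> v; apply: translations_inj; apply: mulVg. Qed.

HB.instance Definition _ := GRing.isZmodule.Build V vaddA vaddC vadd0 vaddN.

Definition lzero : L := coefs_of coef1.
Definition lone : L := coefs_of (coef_unitv s es).
Definition lopp (a : L) : L := coefs_of (coefV (coefsP a)).
Definition ladd (a b : L) : L := coefs_of (coefD good (coefsP a) (coefsP b)).
Definition lmul (a b : L) : L := coefs_of (coefM good (coefsP a) (coefsP b)).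
Definition linv (a : L) : L := coefs_of (coef_sinv (coefsP a)).

Lemma laddA : associative ladd.
Proof. by move=> a b c; apply: coefs_inj; apply: mulgA. Qed.
Lemma laddC : commutative ladd.
Proof.
move=> a b; apply: coefs_inj; apply: trC;
  exact/(translation_coef good)/coefsP.
Qed.
Lemma ladd0 : left_id lzero ladd.
Proof. by move=> a; apply: coefs_inj; apply: mul1g. Qed.
Lemma laddN : left_inverse lzero lopp ladd.
Proof. by move=> a; apply: coefs_inj; apply: mulVg. Qed.

HB.instance Definition _ := GRing.isZmodule.Build L laddA laddC ladd0 laddN.

Lemma lmulA : associative lmul.
Proof.
move=> a b c; apply: coefs_inj; apply/esym/(smulA good); try exact: coefsP.
exact/(translation_coef good)/coefsP.
Qed.
Lemma lmulC : commutative lmul.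
Proof. by move=> a b; apply: coefs_inj; apply: (smulC good); apply: coefsP. Qed.
Lemma lmul1 : left_id lone lmul.
Proof.
move=> a; apply: coefs_inj; apply: (unit_smul good).
exact/(translation_coef good)/coefsP.
Qed.
Lemma lmulDl : left_distributive lmul ladd.
Proof.
move=> a b c; apply: coefs_inj; apply: (smulDl good); try exact: coefsP.
exact/(translation_coef good)/coefsP.
Qed.
Lemma lone_neq0 : lone != lzero.
Proof. by apply/eqP => /(congr1 sval) /= /(frame_unitv_neq1 good). Qed.

HB.instance Definition _ := GRing.Zmodule_isComNzRing.Build L
  lmulA lmulC lmul1 lmulDl lone_neq0.

Lemma lmulV (a : L) : a != 0%R -> (linv a * a = 1)%R.
Proof.
move=> a0; apply: coefs_inj; apply: (sinvP good); first exact: coefsP.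
by move=> a1; case/eqP: a0; apply: coefs_inj.
Qed.
Lemma linv0 : linv 0%R = 0%R.
Proof. by apply: coefs_inj; rewrite /= /sinv eqxx. Qed.

HB.instance Definition _ := GRing.ComNzRing_isField.Build L lmulV linv0.

Definition vscale (a : L) (v : V) : V :=
  translations_of (smul_tr good (coefsP a) (translationsP v)).

Lemma vscaleA (a b : L) v : vscale a (vscale b v) = vscale (a * b)%R v.
Proof.
apply: translations_inj; apply/esym/(smulA good); try exact: coefsP.
exact: translationsP.
Qed.
Lemma vscale1 : left_id 1%R vscale.
Proof.
move=> v; apply: translations_inj; apply: (unit_smul good).
exact: translationsP.
Qed.
Lemma vscaleDr : right_distributive vscale +%R.
Proof. by move=> a v w; apply: translations_inj; apply: smulDr. Qed.
Lemma vscaleDl v : {morph vscale^~ v : a b / (a + b)%R}.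
Proof.
move=> a b; apply: translations_inj; apply: (smulDl good); try exact: coefsP.
exact: translationsP.
Qed.

HB.instance Definition _ := GRing.Zmodule_isLmodule.Build L V
  vscaleA vscale1 vscaleDr vscaleDl.

End FrameField.

(** * Coordinates *)

Section SpanCoordinates.
Local Open Scope ring_scope.

Lemma ltn_ord_max m (i : 'I_m.+1) : i != ord_max -> (i < (ord_max : 'I_m.+1))%N.
Proof. by move=> i_neq; rewrite ltn_neqAle val_eqE i_neq -ltnS ltn_ord. Qed.

Lemma ord_ltn_eqF m (i j : 'I_m) : (j < i)%N -> (j == i) = false.
Proof. by move=> lt_ji; rewrite -(inj_eq val_inj) ltn_eqF. Qed.

(** Stated for any parametrization [lin] of the translations by row vectors over
    a ring [R]: it is applied with [R] the field of an abstract frame, and with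
    [R = F] in T_n(F), before a frame is available there. *)
Lemma span_drop_lincomb (G : groupType) (s : G) es (R : nzRingType) m
    (lin : 'rV[R]_m -> G) :
    size es = m ->
    (forall x y, lin (x + y) = (lin x * lin y)%g) -> lin 0 = 1%g ->
    (forall (i : 'I_m) y, (exists x, scale s es x (nth 1%g es i) y) <->
                          exists a, y = lin (a *: delta_mx 0 i)) ->
  forall i b, (i <= m)%N -> span s es (drop i es) b <->
    exists x : 'rV[R]_m,
      (forall j : 'I_m, (j < i)%N -> x 0 j = 0) /\ b = lin x.
Proof.
move=> size_es linD lin0 scaleE i b.
have [k kE] : exists k, k = (m - i)%N by eexists.
elim: k => [|k IHk] in i b kE * => le_im.
  have iE : i = m by apply/eqP; rewrite eqn_leq le_im -subn_eq0 -kE.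
  rewrite (_ : drop i es = [::]) /=; last by rewrite iE -size_es drop_size.
  split=> [-> | [x [x0 ->]]].
    by exists 0; split=> [j _|]; rewrite ?mxE.
  suff -> : x = 0 by [].
  by apply/rowP => j; rewrite mxE x0 // iE.
have lt_im : (i < m)%N by rewrite -subn_gt0 -kE.
have {}kE : k = (m - i.+1)%N by rewrite subnS -kE.
have {}IHk c := IHk i.+1 c kE lt_im.
pose i' := Ordinal lt_im.
rewrite (drop_nth 1%g) ?size_es //=.
split=> [[a [y [c [ye [/IHk[x [x0 ->]] ->]]]]] | [x [x0 ->]]].
  have [b' ->] := proj1 (scaleE i' y) (ex_intro _ a ye).
  exists (b' *: delta_mx 0 i' + x); split=> [j lt_ji|]; last by rewrite linD.
  rewrite !mxE x0; last by apply: ltn_trans lt_ji _.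
  by rewrite addr0 (@ord_ltn_eqF _ i') // andbF mulr0.
have [|a ye] := proj2 (scaleE i' (lin (x 0 i' *: delta_mx 0 i'))) _.
  by eexists.
exists a, (lin (x 0 i' *: delta_mx 0 i')), (lin (x - x 0 i' *: delta_mx 0 i')).
split=> //; split; last by rewrite -linD addrC subrK.
apply/IHk; eexists; split; last by [].
move=> j; rewrite ltnS leq_eqVlt => /orP[/eqP ji | lt_ji].
  by rewrite (_ : j = i') ?mxE ?eqxx ?mulr1 ?subrr //; apply/val_inj.
by rewrite !mxE (x0 j) // (@ord_ltn_eqF _ i') // andbF mulr0 subrr.
Qed.

End SpanCoordinates.

Section FrameCoordinates.
Local Open Scope ring_scope.
Variables (G : groupType) (s : G) (es : seq G) (good : frame s es).
Implicit Types (b c g : G).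

Local Notation L := (coefs good).
Local Notation V := (translations good).
Local Notation m := (size es).

Definition basis_vec (i : 'I_m) : V :=
  translations_of good (frame_tr good (ltn_ord i)).

Definition lincomb (x : 'rV[L]_m) : V := \sum_j x 0 j *: basis_vec j.

Lemma lincomb_is_linear : linear lincomb.
Proof.
move=> a x y; rewrite /lincomb scaler_sumr -big_split /=.
by apply: eq_bigr => j _; rewrite !mxE scalerDl scalerA.
Qed.

HB.instance Definition _ :=
  GRing.isLinear.Build L 'rV[L]_m V *:%R lincomb lincomb_is_linear.

Lemma lincomb_delta i : lincomb (delta_mx 0 i) = basis_vec i.
Proof.
rewrite /lincomb (bigD1 i) //= mxE !eqxx scale1r big1 ?addr0 // => j ji.
by rewrite mxE (negbTE ji) andbF scale0r.
Qed.

Lemma span_dropP i b : (i <= m)%N ->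
  span s es (drop i es) b <->
  exists x : 'rV[L]_m,
    (forall j : 'I_m, (j < i)%N -> x 0 j = 0) /\ b = sval (lincomb x).
Proof.
have sval_linD (x y : 'rV[L]_m) :
    sval (lincomb (x + y)) = (sval (lincomb x) * sval (lincomb y))%g.
  by rewrite linearD.
have sval_lin0 : sval (lincomb 0) = 1%g by rewrite linear0.
apply: (span_drop_lincomb (s := s) (erefl m) sval_linD sval_lin0).
have linE (a : L) k :
    sval (lincomb (a *: delta_mx 0 k)) = smul s es (sval a) (nth 1%g es k).
  transitivity (sval (a *: lincomb (delta_mx 0 k))); first by rewrite -linearZZ.
  by rewrite lincomb_delta.
move=> k y; split=> [[x] | [a ->]].
  move=> /(scaleP good x y (frame_tr good (ltn_ord k)))[ca ->].
  by exists (coefs_of good ca); rewrite linE.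
exists (sval a); apply/(scaleP good _ _ (frame_tr good (ltn_ord k))).
by split; [exact: coefsP | rewrite linE].
Qed.

(** In a nontrivial relation, the basis vector with the first nonzero
    coefficient would lie in the span of the following ones. *)
Lemma lincomb_inj : injective lincomb.
Proof.
move=> x y /eqP; rewrite -subr_eq0 -linearB => /eqP lin0.
apply/eqP; rewrite -subr_eq0; apply/eqP; move: (x - y) lin0 => {x y} x lin0.
suff x0 : forall k (j : 'I_m), (j < k)%N -> x 0 j = 0.
  by apply/rowP => j; rewrite mxE (x0 m).
elim=> [//|k IHk j]; rewrite ltnS leq_eqVlt => /orP[/eqP jk | /IHk//].
apply/eqP/negPn/negP => xj0; apply: (frame_indep good (ltn_ord j)).
apply/span_dropP => //; exists (delta_mx 0 j - (x 0 j)^-1 *: x); split.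
  move=> i; rewrite ltnS leq_eqVlt => /orP[/eqP ij | lt_ij].
    by rewrite (val_inj ij) !mxE !eqxx mulVf ?subrr.
  rewrite !mxE (IHk i) -?jk // mulr0 subr0.
  by rewrite (@ord_ltn_eqF _ j) ?andbF.
rewrite linearB linearZZ lin0 scaler0 subr0 -[RHS]/(sval (lincomb _)).
by rewrite lincomb_delta.
Qed.

Lemma lincomb_surj v : exists x, lincomb x = v.
Proof.
have := frame_span good (translationsP v).
rewrite -[X in span _ _ X _]drop0 => /span_dropP-/(_ isT)[x [_ xE]].
by exists x; apply: translations_inj.
Qed.

Definition coord (v : V) : 'rV[L]_m := projT1 (cid (lincomb_surj v)).

Lemma coordK : cancel coord lincomb.
Proof. by move=> v; rewrite /coord; case: cid. Qed.

Lemma lincombK : cancel lincomb coord.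
Proof. by move=> x; apply: lincomb_inj; rewrite coordK. Qed.

Lemma coord_is_linear : linear coord.
Proof. by move=> a v w; apply: lincomb_inj; rewrite linearP /= !coordK. Qed.

HB.instance Definition _ :=
  GRing.isLinear.Build L V 'rV[L]_m *:%R coord coord_is_linear.

Lemma coordD v w : coord (v + w) = coord v + coord w.
Proof. exact: linearD. Qed.

Lemma coord0 : coord 0 = 0. Proof. exact: linear0. Qed.

(** Total, so that no membership proof occurs in [conj_mx]. *)
Definition vconj c (v : V) : V :=
  if pselect (cent s c) is left cc
  then translations_of good (translationJ cc (translationsP v)) else 0.

Lemma sval_vconj c v : cent s c -> sval (vconj c v) = (sval v ^ c)%g.
Proof. by rewrite /vconj; case: pselect. Qed.

Lemma vconj_is_linear c : cent s c -> linear (vconj c).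
Proof.
move=> cc a v w; apply: translations_inj; rewrite sval_vconj //.
rewrite conjMg; congr (_ * _)%g; last by rewrite sval_vconj.
rewrite -[RHS]/(smul _ _ _ _) sval_vconj //.
by apply: (smulJ good) => //; [apply: coefsP | apply: translationsP].
Qed.

(** Row convention: conjugation by [c * d] acts by [c] first, so [conj_mx] is
    multiplicative and not anti-multiplicative. *)
Definition conj_mx c : 'M[L]_m := \matrix_i coord (vconj c (basis_vec i)).

Lemma vconj_lincomb c x :
  cent s c -> vconj c (lincomb x) = lincomb (x *m conj_mx c).
Proof.
move=> cc; pose h := GRing.isLinear.Build L V V *:%R _ (vconj_is_linear cc).
pose hc : {linear V -> V} := HB.pack (vconj c) h.
rewrite -[vconj c]/(hc : V -> V) mulmx_sum_row !linear_sum.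
apply: eq_bigr => j _; rewrite !linearZ /= rowK coordK //.
Qed.

Lemma coord_vconj c v : cent s c -> coord (vconj c v) = coord v *m conj_mx c.
Proof. by move=> cc; rewrite -{1}(coordK v) vconj_lincomb // lincombK. Qed.

Lemma conj_mx1 : conj_mx 1%g = 1%:M.
Proof.
apply/row_matrixP => i; rewrite rowK row1; apply: lincomb_inj.
rewrite coordK lincomb_delta; apply: translations_inj.
by rewrite sval_vconj ?conjg1 //; apply: commute1.
Qed.

Lemma conj_mxM c d : cent s c -> cent s d ->
  conj_mx (c * d)%g = conj_mx c *m conj_mx d.
Proof.
move=> cc cd; apply/row_matrixP => i; rewrite row_mul !rowK -coord_vconj //.
congr coord; apply: translations_inj.
by rewrite !sval_vconj ?conjgM //; apply: centM.
Qed.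

Lemma conj_mx_upper c (i j : 'I_m) :
  cent s c -> (j < i)%N -> conj_mx c i j = 0.
Proof.
move=> cc lt_ji; have := frame_flag good (ltn_ord i) cc.
move/span_dropP => /(_ (ltnW (ltn_ord i)))[x [x0 xE]].
rewrite mxE -[X in coord X](_ : lincomb x = _) ?lincombK ?x0 //.
by apply: translations_inj; rewrite -xE sval_vconj.
Qed.

Lemma conj_mx_utriang c : cent s c -> upper_unitmx (conj_mx c).
Proof.
move=> cc; apply/upper_unitmxP; split=> [i j|]; first exact: conj_mx_upper.
case: (@mulmx1_unit _ _ (conj_mx c) (conj_mx c^-1%g)) => //.
by rewrite -conj_mxM ?mulgV ?conj_mx1 //; apply: centV.
Qed.

(** The rows of [M] are the coordinates of admissible images of the basis
    vectors. *)
Lemma conj_mx_surj M : upper_unitmx M -> exists2 c, cent s c & conj_mx c = M.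
Proof.
move=> uM; have /upper_unitmxP[tM _] := uM.
have nzM i : M i i != 0.
  have /andP[tTM] := uM; rewrite unitmxE -det_tr det_trig // unitfE.
  by move=> /prodf_neq0/(_ i isT); rewrite mxE.
pose bs := [seq sval (lincomb (row i M)) | i <- enum 'I_m].
have szb : size bs = m by rewrite size_map size_enum_ord.
have bsE (i : 'I_m) : nth 1%g bs i = sval (lincomb (row i M)).
  by rewrite (nth_map i) ?size_enum_ord // nth_ord_enum.
have [i lt_im | c [cc cE]] := frame_full good szb.
  have := bsE (Ordinal lt_im) => /= ->; split.
    apply/(span_dropP _ (ltnW lt_im)); exists (row (Ordinal lt_im) M).
    by split=> // j lt_ji; rewrite mxE tM.
  move/(span_dropP _ lt_im) => [x [x0 /translations_inj/lincomb_inj xE]].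
  have /rowP/(_ (Ordinal lt_im)) := xE; rewrite mxE x0 // => M0.
  by have := nzM (Ordinal lt_im); rewrite M0 eqxx.
exists c => //; apply/row_matrixP => i; rewrite rowK; apply: lincomb_inj.
rewrite coordK; apply: translations_inj; rewrite sval_vconj // -bsE.
exact: cE.
Qed.

(** Being the identity on a basis, conjugation by [c] fixes [es]; the last
    condition on frames applies. *)
Lemma conj_mx1_central c : cent s c -> conj_mx c = 1%:M -> center c.
Proof.
move=> cc cE; apply: (frame_faithful good) => // i lt_im.
have /(congr1 sval) :
    vconj c (basis_vec (Ordinal lt_im)) = basis_vec (Ordinal lt_im).
  by rewrite -(coordK (vconj _ _)) coord_vconj // cE mulmx1 coordK.
by rewrite sval_vconj.
Qed.

End FrameCoordinates.

(** * Block decomposition of triangular matrices *)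

Section TriangularBlocks.
Local Open Scope ring_scope.
Variables (F : fieldType) (m : nat).
Implicit Types (a : F) (v : 'rV[F]_m) (M : 'M[F]_m) (g : utriang m.+1 F).

Lemma upper_unitmx_diag p (A : 'M[F]_p) i : upper_unitmx A -> A i i != 0.
Proof.
case/andP=> tTA; rewrite unitmxE -det_tr det_trig // unitfE.
by move=> /prodf_neq0/(_ i isT); rewrite mxE.
Qed.

Lemma upper_unitmxI p (A : 'M[F]_p) :
  (forall i j : 'I_p, (j < i)%N -> A i j = 0) -> (forall i, A i i != 0) ->
  upper_unitmx A.
Proof.
move=> tA nzA; have tTA : is_trig_mx A^T.
  by apply/is_trig_mxP => i j /tA; rewrite mxE.
apply/andP; split=> //; rewrite unitmxE -det_tr det_trig // unitfE.
by apply/prodf_neq0 => i _; rewrite mxE.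
Qed.

Lemma upper_unitmx_scalar p a : a != 0 -> upper_unitmx (a%:M : 'M[F]_p).
Proof.
move=> a0; apply: upper_unitmxI => [i j lt_ji | i]; rewrite mxE ?eqxx //.
by rewrite -val_eqE gtn_eqF.
Qed.

Lemma upper_unitmx_elementary p (i j : 'I_p) a : (i < j)%N ->
  upper_unitmx (1%:M + a *: delta_mx i j : 'M[F]_p).
Proof.
move=> lt_ij; apply: upper_unitmxI => [k l lt_lk | k]; rewrite !mxE.
  rewrite -[k == l]val_eqE gtn_eqF // add0r.
  have [ki | _] := eqVneq k i; last by rewrite mulr0.
  have [lj | _] := eqVneq l j; last by rewrite mulr0.
  by rewrite ki lj ltnNge ltnW in lt_lk.
rewrite eqxx; have [-> | _] := eqVneq k i; last first.
  by rewrite mulr0 addr0 oner_neq0.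
by rewrite -[i == j]val_eqE ltn_eqF // mulr0 addr0 oner_neq0.
Qed.

Lemma upper_unitmx_block a v M : a != 0 -> upper_unitmx M ->
  upper_unitmx (block_mx a%:M v 0 M : 'M_m.+1).
Proof.
move=> a0 uM; have /upper_unitmxP[tM _] := uM.
apply: upper_unitmxI => [i j | i].
  case: (@split_ordP 1 m i) => i' ->; case: (@split_ordP 1 m j) => j' -> /=.
  - by rewrite !ord1.
  - by rewrite [i']ord1.
  - by rewrite [LHS]block_mxEdl mxE.
  by rewrite /= ltnS => lt_ji; rewrite [LHS]block_mxEdr tM.
case: (@split_ordP 1 m i) => i' ->.
  by rewrite [X in X != 0]block_mxEul !ord1 mxE eqxx.
by rewrite [X in X != 0]block_mxEdr upper_unitmx_diag.
Qed.

(** The matrix [[a, v], [0, M]]. The default value of [insubd] makes it a total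
    function, to be used only with [a] nonzero and [M] triangular invertible. *)
Definition utblock a v M : utriang m.+1 F :=
  insubd (1%g : utriang m.+1 F) (block_mx a%:M v 0 M : 'M_m.+1).

Lemma umx_utblock a v M : a != 0 -> upper_unitmx M ->
  umx (utblock a v M) = block_mx a%:M v 0 M :> 'M_m.+1.
Proof. by move=> a0 uM; rewrite [LHS]insubdK //; apply: upper_unitmx_block. Qed.

Lemma utblockM a v M a' v' M' :
  a != 0 -> upper_unitmx M -> a' != 0 -> upper_unitmx M' ->
  (utblock a v M * utblock a' v' M')%g =
  utblock (a * a') (a *: v' + v *m M') (M *m M').
Proof.
move=> a0 uM a'0 uM'; apply: val_inj.
rewrite [RHS]umx_utblock ?mulf_neq0 ?upper_unitmxM //.
rewrite -[LHS]/(umx (utblock a v M) *m umx (utblock a' v' M')).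
rewrite !umx_utblock //; transitivity
  (block_mx a%:M v 0 M *m block_mx a'%:M v' 0 M' : 'M_(1 + m)) => //.
rewrite mulmx_block.
by rewrite -scalar_mxM mul_scalar_mx !mulmx0 !mul0mx !addr0 add0r.
Qed.

Lemma utblock1 : utblock 1 0 1%:M = 1%g.
Proof.
apply: val_inj; rewrite [LHS]umx_utblock ?oner_neq0 ?upper_unitmx1 //.
by rewrite -(scalar_mx_block 1 m 1).
Qed.

Lemma utblock_inj a v M a' v' M' :
  a != 0 -> upper_unitmx M -> a' != 0 -> upper_unitmx M' ->
  utblock a v M = utblock a' v' M' -> [/\ a = a', v = v' & M = M'].
Proof.
move=> a0 uM a'0 uM' /(congr1 val); rewrite /= !umx_utblock //.
case/(@eq_block_mx _ 1 m 1 m)=> /(congr1 (fun A : 'M[F]_1 => A 0 0)) + -> _ ->.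
by rewrite !mxE !eqxx.
Qed.

Lemma utblockP g :
  exists a v M, [/\ a != 0, upper_unitmx M & g = utblock a v M].
Proof.
pose A : 'M_(1 + m) := umx g.
have /upper_unitmxP[tA _] := umxP g.
have nzA i : umx g i i != 0 := upper_unitmx_diag i (umxP g).
have uD : upper_unitmx (drsubmx A).
  apply: upper_unitmxI => [i j lt_ji | i]; rewrite !mxE.
    by apply: (tA (rshift 1 i) (rshift 1 j)); rewrite /= ltnS.
  exact: (nzA (rshift 1 i)).
exists (umx g ord0 ord0), (ursubmx A), (drsubmx A); split=> //.
apply: val_inj; rewrite [RHS]umx_utblock //.
have ulE : ulsubmx A = (umx g ord0 ord0)%:M.
  by rewrite [LHS]mx11_scalar !mxE; congr (umx g _ _)%:M; apply/val_inj.
have dlE : dlsubmx A = 0.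
  by apply/matrixP => i j; rewrite !mxE tA //= [j]ord1.
by rewrite -[LHS]/A -[LHS](@submxK _ 1 m 1 m A) ulE dlE.
Qed.

(** The corner entry is multiplicative with commutative values. *)
Lemma commutator_corner x y a v M : a != 0 -> upper_unitmx M ->
  utblock a v M = [~ x, y]%g -> a = 1.
Proof.
move=> a0 uM E; have := commgC x y; rewrite -{}E.
have [b [p [P [b0 uP ->]]]] := utblockP x.
have [c [q [Q [c0 uQ ->]]]] := utblockP y.
have [bc0 cb0] : b * c != 0 /\ c * b != 0 by rewrite !mulf_neq0.
have [uPQ uQP] := (upper_unitmxM uP uQ, upper_unitmxM uQ uP).
rewrite (utblockM _ _ b0 uP c0 uQ) (utblockM _ _ c0 uQ b0 uP).
rewrite (utblockM _ _ cb0 uQP a0 uM) => /utblock_inj[] //.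
- by rewrite mulf_neq0.
- exact: upper_unitmxM.
by rewrite [b * c]mulrC -{1}[c * b]mulr1 => /(mulfI cb0).
Qed.

Lemma central_utblock a : a != 0 -> center (utblock a 0 a%:M).
Proof.
move=> a0 g; have [b [v [M [b0 uM ->]]]] := utblockP g.
have ua := upper_unitmx_scalar m a0.
rewrite /commute !utblockM // mul0mx addr0 scaler0 add0r mul_mx_scalar.
by rewrite mulrC scalar_mxC.
Qed.

End TriangularBlocks.

(** * The central quotient of a group with a frame *)

Section FrameIso.
Local Open Scope group_scope.
Variables (G : groupType) (s : G) (es : seq G) (good : frame s es).
Implicit Types (b c g : G).

Local Notation L := (coefs good).
Local Notation m := (size es).

Let trM := frame_trM good.
Let trV := frame_trV good.
Let trI := frame_trI good.

Lemma factor g : exists cv : G * translations good,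
  cent s cv.1 /\ g = cv.1 * sval cv.2.
Proof.
have [c [b [cc [tb ->]]]] := frame_factor good g.
by exists (c, translations_of good tb).
Qed.

(** The quotient of two linear parts of the same element is a translation in the
    centralizer of [s], hence trivial. *)
Lemma factor_unique c c' (v v' : translations good) :
  cent s c -> cent s c' -> c * sval v = c' * sval v' -> c = c' /\ v = v'.
Proof.
move=> cc cc' E.
have E' : c'^-1 * c = sval v' * (sval v)^-1.
  by apply: (mulIg (sval v)); rewrite mulgVK -mulgA E mulKg.
have c1 : c'^-1 * c = 1.
  apply: trI; last by apply: centM => //; apply: centV.
  rewrite E'; apply: trM; first exact: translationsP.
  exact/trV/translationsP.
have cE : c = c' by rewrite -(mulVKg c' c) c1 mulg1.
by split=> //; apply: translations_inj; apply: (mulgI c); rewrite E cE.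
Qed.

Definition linear_part g : G := (projT1 (cid (factor g))).1.
Definition translation_part g : translations good :=
  (projT1 (cid (factor g))).2.

Lemma cent_linear_part g : cent s (linear_part g).
Proof. by rewrite /linear_part; case: cid => ? []. Qed.

Lemma factorE g : g = linear_part g * sval (translation_part g).
Proof. by rewrite /linear_part /translation_part; case: cid => ? []. Qed.

Lemma parts_of c (v : translations good) : cent s c ->
  linear_part (c * sval v) = c /\ translation_part (c * sval v) = v.
Proof.
move=> cc; apply: factor_unique => //; first exact: cent_linear_part.
by rewrite -factorE.
Qed.

Lemma parts_mul g h :
  linear_part (g * h) = linear_part g * linear_part h /\
  translation_part (g * h) =
    (vconj (linear_part h) (translation_part g) + translation_part h)%R.
Proof.
have cg := cent_linear_part g; have ch := cent_linear_part h.
rewrite {1 3}(factorE g) {1 3}(factorE h).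
set c := linear_part g; set d := linear_part h.
rewrite (_ : _ * _ = (c * d) *
  sval (vconj d (translation_part g) + translation_part h)%R).
  by apply: parts_of; apply: centM.
rewrite -[X in _ = _ * X]/(sval _ * sval _) sval_vconj // !mulgA.
by congr (_ * _); rewrite -!mulgA -conjgC.
Qed.

Definition affine g : utriang m.+1 L :=
  utblock 1%R (coord (translation_part g)) (conj_mx good (linear_part g)).

Let unit1 : (1 : L)%R != 0%R := oner_neq0 _.

Lemma conj_linear_part g : upper_unitmx (conj_mx good (linear_part g)).
Proof. exact/conj_mx_utriang/cent_linear_part. Qed.

(** If [g = c * v] and [h = d * w] with [c], [d] linear and [v], [w]
    translations, then [g * h = (c * d) * (v ^ d * w)], which is the product
    rule of the block matrices. *)
Lemma affineM g h : affine (g * h) = affine g * affine h.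
Proof.
have [cE vE] := parts_mul g h.
have [cg ch] := (cent_linear_part g, cent_linear_part h).
rewrite /affine.
rewrite (utblockM _ _ unit1 (conj_linear_part g) unit1 (conj_linear_part h)).
rewrite mulr1 scale1r.
rewrite cE vE (conj_mxM good cg ch) coordD (coord_vconj _ ch).
by rewrite addrC.
Qed.

Lemma center_cent z : center z -> cent s z.
Proof. by move=> cz; apply/commute_sym/cz. Qed.

Lemma affine_center z : center z -> affine z = 1.
Proof.
move=> cz.
have zE : z = z * sval (0%R : translations good) by rewrite [RHS]mulg1.
have [cE vE] := @parts_of z 0%R (center_cent cz).
rewrite -zE in cE vE.
rewrite /affine cE vE coord0 -[RHS]utblock1; congr utblock.
apply/row_matrixP => i; rewrite rowK row1; apply: lincomb_inj.
rewrite coordK lincomb_delta; apply: translations_inj.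
rewrite sval_vconj; last exact: center_cent.
exact/conjg_fixP/commgP/commute_sym/cz.
Qed.

Lemma affine_ker g : affine g = 1 -> center g.
Proof.
rewrite -utblock1 => /utblock_inj[].
1-4: by rewrite ?conj_linear_part ?upper_unitmx1.
move=> _ v0 c1.
have -> : g = linear_part g.
  rewrite {1}(factorE g) -(coordK (translation_part g)) v0 linear0.
  exact: mulg1.
exact: (conj_mx1_central (cent_linear_part g) c1).
Qed.

(** The commutator of [g] and [s] is a translation, and it commutes with [s]: it
    is trivial. So [g] is in the linear part, and then its commutator with a
    translation is again a translation commuting with [s]. Hence [g] is linear
    and fixes all translations. *)
Lemma center_of_commutators g : (forall h, center [~ g, h]) -> center g.
Proof.
move=> zg; have cg : cent s g.
  apply/commgP/eqP/trI; first by exists g.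
  rewrite -invgR; apply: centV; exact: center_cent.
apply: (frame_faithful good) => // i lt_im.
have trb := frame_tr good lt_im.
set b := nth 1 es i in trb *.
apply/conjg_fixP/eqP/trI.
  by rewrite commgEl; apply: trM; [apply: trV | apply: translationJ].
by rewrite -invgR; apply: centV; apply: center_cent.
Qed.

Lemma pi_eq_center (K : groupType) (x y : K) :
  \pi_(central_quotient K)%qT x = \pi_(central_quotient K)%qT y <->
  exists2 z, center z & y = x * z.
Proof.
split=> [/eqmodP/eqmod_centerP // | zP].
by apply/eqmodP/eqmod_centerP.
Qed.

(** Only matrices with corner entry 1 are in the image, and every triangular
    matrix is such a matrix up to a scalar one. *)
Lemma affine_surj A : exists g z, center z /\ A = affine g * z.
Proof.
have [a [v [M [a0 uM ->]]]] := utblockP A.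
have uM' : upper_unitmx (a^-1 *: M)%R.
  have /upper_unitmxP[tM _] := uM.
  apply: upper_unitmxI => [i j lt_ji | i]; rewrite mxE.
    by rewrite tM // mulr0.
  by rewrite mulf_neq0 ?invr_neq0 ?upper_unitmx_diag.
have [c cc cE] := conj_mx_surj uM'.
exists (c * sval (lincomb (a^-1 *: v)%R)), (utblock a 0%R a%:M%R).
split; first exact: central_utblock.
rewrite /affine; have [-> ->] := @parts_of c (lincomb (a^-1 *: v)%R) cc.
have ua := upper_unitmx_scalar m a0.
rewrite cE lincombK (utblockM _ _ unit1 uM' a0 ua) mul1r scaler0 add0r.
rewrite !mul_mx_scalar !scalerA.
by rewrite (divff a0) !scale1r.
Qed.

Let P := putriang m.+1 L.

Definition central_affine (q : central_quotient G) : P :=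
  \pi_(central_quotient (utriang m.+1 L))%qT (affine (repr q)).

Lemma central_affine_pi g : central_affine (\pi_(central_quotient G)%qT g) =
  \pi_(central_quotient (utriang m.+1 L))%qT (affine g).
Proof.
rewrite /central_affine; case: piP => h /pi_eq_center[z cz ->].
by rewrite affineM (affine_center cz) mulg1.
Qed.

Lemma central_affineM : {morph central_affine : p q / p * q}.
Proof.
elim/quotW => g; elim/quotW => h.
rewrite -[X in central_affine X](pi_cq_mul g h) !central_affine_pi affineM.
exact: pi_cq_mul.
Qed.

Lemma affineV g : affine g^-1 = (affine g)^-1.
Proof.
apply: (mulgI (affine g)); rewrite mulgV -affineM mulgV.
by apply: affine_center => y; apply/commute_sym/commute1.
Qed.

Lemma affineR g h : affine [~ g, h] = [~ affine g, affine h].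
Proof. by rewrite /commg /conjg !affineM !affineV. Qed.

Lemma center_commg (K : groupType) (x y : K) : center x -> [~ x, y] = 1.
Proof. by move=> cx; apply/eqP/commgP/cx. Qed.

(** If [affine g] is central, then the commutators of [g] are in the kernel of
    [affine], which is central; [center_of_commutators] applies to [g]. *)
Lemma central_affine_inj : injective central_affine.
Proof.
elim/quotW => g; elim/quotW => h; rewrite !central_affine_pi => /pi_eq_center.
case=> A cA hE; apply/pi_eq_center; exists (g^-1 * h); last by rewrite mulVKg.
have AE : affine (g^-1 * h) = A by rewrite affineM affineV hE mulKg.
apply: center_of_commutators => k; apply: affine_ker.
rewrite affineR AE; exact: center_commg.
Qed.

Lemma central_affine_bij : bijective central_affine.
Proof.
have surj (p : P) : exists q, central_affine q = p.
  elim/quotW: p => A; have [g [z [cz ->]]] := affine_surj A.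
  exists (\pi_(central_quotient G)%qT g); rewrite central_affine_pi.
  by apply/pi_eq_center; exists z.
exists (fun p => projT1 (cid (surj p))) => [q | p]; last by case: cid.
by apply: central_affine_inj; case: cid.
Qed.

HB.instance Definition _ :=
  isMultiplicative.Build (central_quotient G) P central_affine central_affineM.

Theorem frame_isomorphic : isomorphic (central_quotient G) P.
Proof. by exists central_affine; apply: central_affine_bij. Qed.

End FrameIso.

(** * The standard frame of the triangular group *)

Section StandardFrame.
Local Open Scope ring_scope.
Variables (F : fieldType) (m' : nat).
Local Notation m := m'.+1.
Local Notation T := (utriang m.+1 F).
Implicit Types (a d : F) (v w : 'rV[F]_m) (M : 'M[F]_m) (g : T).

Let nz1 : (1 : F) != 0 := oner_neq0 F.
Let up1 : upper_unitmx (1%:M : 'M[F]_m) := upper_unitmx1 m F.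

Definition row_translation w : T := utblock 1 w 1%:M.
Local Notation tv := row_translation.

Lemma row_translationD v w : tv (v + w) = (tv v * tv w)%g.
Proof. by rewrite /tv utblockM // mulr1 scale1r !mulmx1 addrC. Qed.

Lemma row_translation0 : tv 0 = 1%g. Proof. exact: utblock1. Qed.

Lemma row_translationN v : tv (- v) = (tv v)^-1%g.
Proof.
apply: (mulgI (tv v)).
by rewrite -row_translationD subrr mulgV row_translation0.
Qed.

Lemma row_translation_inj : injective tv.
Proof. by move=> v w /utblock_inj[]. Qed.

Lemma row_translationJ w a v M : a != 0 -> upper_unitmx M ->
  (tv w ^ utblock a v M)%g = tv (a^-1 *: (w *m M)).
Proof.
move=> a0 uM; rewrite conjgE; apply: (canLR (mulKg _)).
rewrite /tv !utblockM // mulr1 mul1r scale1r !mulmx1 mul1mx.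
by rewrite scalerA divff // scale1r addrC.
Qed.

Definition std_vecs : seq T :=
  [seq tv (delta_mx 0 i) | i <- enum 'I_m].
Local Notation es := std_vecs.
Local Notation delta := (delta_mx 0 (ord_max : 'I_m) : 'rV[F]_m).

Lemma size_std_vecs : size es = m.
Proof. by rewrite size_map size_enum_ord. Qed.

Lemma nth_std_vecs (i : 'I_m) : nth 1%g es i = tv (delta_mx 0 i).
Proof. by rewrite (nth_map i) ?size_enum_ord // nth_ord_enum. Qed.

Lemma unitv_std_vecs : unitv es = tv delta.
Proof.
by rewrite /unitv -[RHS]nth_std_vecs -(nth_last 1%g) size_std_vecs.
Qed.

Lemma row_max_upper M : upper_unitmx M ->
  delta *m M = M ord_max ord_max *: delta.
Proof.
case/upper_unitmxP=> tM _; rewrite -rowE; apply/rowP => j; rewrite !mxE eqxx /=.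
have [-> | j_neq] := eqVneq j ord_max; first by rewrite mulr1.
by rewrite mulr0 tM // ltn_ord_max.
Qed.

Variables (t : F) (t0 : t != 0) (t1 : t != 1).

Definition std_homothety : T := utblock t 0 1%:M.
Local Notation s := std_homothety.

Lemma cent_stdP a v M : a != 0 -> upper_unitmx M ->
  cent s (utblock a v M) <-> v = 0.
Proof.
move=> a0 uM; rewrite /cent /commute /s !utblockM //.
rewrite !mul0mx !mulmx1 !mul1mx scaler0 add0r addr0 [a * t]mulrC.
split=> [/utblock_inj[] | ->]; rewrite ?scaler0 ?mulf_neq0 //.
move=> _ /eqP; rewrite -subr_eq0 -[X in _ - X]scale1r -scalerBl scaler_eq0.
by rewrite subr_eq0 (negbTE t1) => /eqP.
Qed.

Lemma translation_std a v M : a != 0 -> upper_unitmx M ->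
  [~ s, utblock a v M]%g = tv ((t * a)^-1 *: ((t - 1) *: v)).
Proof.
move=> a0 uM; apply: (mulgI (utblock a v M * s)%g); rewrite -commgC.
have ta0 : t * a != 0 by rewrite mulf_neq0.
rewrite /s /tv !utblockM ?mulf_neq0 ?upper_unitmxM // [a * t]mulrC.
rewrite !mul0mx !mulmx1 !mul1mx scaler0 add0r mulr1 scalerA divff // scale1r.
by rewrite addr0 scalerBl scale1r subrK.
Qed.

(** Since [t] is neither 0 nor 1, the equation of [translation_std] can be
    solved for [v]. *)
Lemma translation_stdP b : translation s b <-> exists w, b = tv w.
Proof.
split=> [[g ->] | [w ->]].
  have [a [v [M [a0 uM ->]]]] := utblockP g.
  by rewrite translation_std //; eexists.
exists (utblock 1 ((t - 1)^-1 *: (t *: w)) 1%:M); rewrite translation_std //.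
by rewrite mulr1 !scalerA mulfK ?subr_eq0 // mulVf // scale1r.
Qed.

(** A linear part [M] which commutes with the diagonal matrices having a single
    entry [t], and 1 elsewhere on the diagonal, is diagonal; if it commutes with
    the elementary matrices as well, its diagonal is constant. *)
Lemma scal_stdP z : scal s z <->
  exists a d, [/\ a != 0, d != 0 & z = utblock a 0 d%:M].
Proof.
split=> [[+ zC] | [a [d [a0 d0 ->]]]]; last first.
  have ud := upper_unitmx_scalar m d0.
  split=> [|c]; first exact/cent_stdP.
  have [b [v [M [b0 uM ->]]]] := utblockP c.
  move/(cent_stdP v b0 uM) => ->; rewrite /commute !utblockM //.
  by rewrite !scaler0 !mul0mx mulrC scalar_mxC.
have [a [v [M [a0 uM zE]]]] := utblockP z.
rewrite {1}zE => /(cent_stdP _ a0 uM) v0; rewrite {}v0 in zE.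
have MC N : upper_unitmx N -> M *m N = N *m M.
  move=> uN; have /zC : cent s (utblock 1 0 N) by apply/cent_stdP.
  rewrite zE /commute !utblockM // => /utblock_inj[];
    by rewrite ?mulf_neq0 ?upper_unitmxM.
have /upper_unitmxP[tM _] := uM.
have offdiag i j : i != j -> M i j = 0.
  move=> ij; pose D : 'M[F]_m := diag_mx (\row_k if k == j then t else 1).
  have uD : upper_unitmx D.
    apply: upper_unitmxI => [k l lt_lk | k]; rewrite !mxE.
      by rewrite [k == l]eq_sym (ord_ltn_eqF lt_lk).
    by rewrite eqxx mulr1n; case: ifP.
  have /matrixP/(_ i j) := MC _ uD; rewrite mul_mx_diag mul_diag_mx !mxE.
  rewrite eqxx (negbTE ij) mul1r => /eqP.
  rewrite -subr_eq0 -{2}[M i j]mulr1 -mulrBr mulf_eq0 subr_eq0 (negbTE t1) orbF.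
  by move/eqP.
have diag i : M i i = M ord_max ord_max.
  have [-> // | i_neq] := eqVneq i ord_max.
  have lt_im := ltn_ord_max i_neq.
  have /matrixP/(_ i ord_max) := MC _ (upper_unitmx_elementary 1 lt_im).
  rewrite scale1r mulmxDr mulmxDl mulmx1 mul1mx !mxE => /addrI.
  rewrite (bigD1 i) //= big1 ?addr0 => [|k ki]; last first.
    by rewrite mxE (negbTE ki) mulr0.
  rewrite (bigD1 ord_max) //= big1 ?addr0 => [|k ki]; last first.
    by rewrite mxE (negbTE ki) andbF mul0r.
  by rewrite !mxE !eqxx mulr1 mul1r.
exists a, (M ord_max ord_max); split=> //; first exact: upper_unitmx_diag.
rewrite zE; congr utblock; apply/matrixP => i j; rewrite mxE.
by case: eqVneq => [-> | /offdiag].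
Qed.

Lemma row_translation_homothety w a d : a != 0 -> d != 0 ->
  (tv w ^ utblock a 0 d%:M)%g = tv ((a^-1 * d) *: w).
Proof.
move=> a0 d0; rewrite row_translationJ ?upper_unitmx_scalar //.
by rewrite mul_mx_scalar scalerA.
Qed.

Lemma scale_stdP x w y : scale s es x (tv w) y <->
  exists a, x = tv (a *: delta) /\ y = tv (a *: w).
Proof.
rewrite /scale unitv_std_vecs; split.
  case=> [[-> ->] | [z [/scal_stdP[a [d [a0 d0 ->]]] [-> ->]]]].
    by exists 0; rewrite !scale0r row_translation0.
  by exists (a^-1 * d); rewrite !row_translation_homothety.
move=> [a [-> ->]]; have [-> | a0] := eqVneq a 0.
  by left; rewrite !scale0r row_translation0.
right; exists (utblock 1 0 a%:M); split; first by apply/scal_stdP; exists 1, a.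
by rewrite !row_translation_homothety // invr1 mul1r.
Qed.

Lemma coef_stdP x : coef s es x <-> exists a, x = tv (a *: delta).
Proof.
have [l r] := scale_stdP x delta x; split=> [cx | [a xE]].
  have /l[a [xE _]] : scale s es x (tv delta) x; last by exists a.
  rewrite /scale unitv_std_vecs; case: cx => [x1 | [z [sz xE]]]; first by left.
  by right; exists z; rewrite -unitv_std_vecs.
by case: r => [|[-> _] | [z [sz [xz _]]]]; [exists a | left | right; exists z].
Qed.

Lemma span_drop_stdP i b : (i <= m)%N -> span s es (drop i es) b <->
  exists w : 'rV[F]_m, (forall j : 'I_m, (j < i)%N -> w 0 j = 0) /\ b = tv w.
Proof.
apply: (span_drop_lincomb size_std_vecs row_translationD row_translation0).
move=> k y; rewrite nth_std_vecs; split=> [[x /scale_stdP[a [_ ->]]] | [a ->]].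
  by exists a.
by exists (tv (a *: delta)); apply/scale_stdP; exists a.
Qed.

Lemma std_translation_frame : translation_frame s.
Proof.
split=> [b c /translation_stdP[v ->] /translation_stdP[w ->] |].
  by apply/translation_stdP; rewrite -row_translationD; eexists.
split=> [b /translation_stdP[v ->] |].
  by apply/translation_stdP; rewrite -row_translationN; eexists.
split=> [b c /translation_stdP[v ->] /translation_stdP[w ->] |].
  by rewrite /commute -!row_translationD addrC.
split=> [g | b /translation_stdP[w ->]]; last first.
  by move/(cent_stdP _ nz1 up1) => ->; apply: row_translation0.
have [a [v [M [a0 uM ->]]]] := utblockP g.
exists (utblock a 0 M), (tv (a^-1 *: v)); split; first exact/cent_stdP.
split; first by apply/translation_stdP; eexists.
rewrite /row_translation utblockM // mulr1 mul0mx addr0 mulmx1 scalerA.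
by rewrite divff // scale1r.
Qed.

Lemma unitv_conj a v M : a != 0 -> upper_unitmx M -> forall c,
  (tv (c *: delta) ^ utblock a v M)%g =
  tv ((a^-1 * M ord_max ord_max * c) *: delta).
Proof.
move=> a0 uM c; rewrite row_translationJ // -scalemxAl row_max_upper //.
by rewrite !scalerA -mulrA [c * _]mulrC.
Qed.

Lemma delta_scale_inj c d : c *: delta = d *: delta -> c = d.
Proof. by move/rowP/(_ ord_max); rewrite !mxE !eqxx !mulr1. Qed.

(** The line of [delta] is normal in the whole group, which acts on it through a
    character with values in the nonzero elements of [F]. *)
Lemma delta_charP g : exists k, k != 0 /\
  forall c, (tv (c *: delta) ^ g)%g = tv ((k * c) *: delta).
Proof.
have [a [v [M [a0 uM ->]]]] := utblockP g.
exists (a^-1 * M ord_max ord_max); split; last exact: unitv_conj.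
by rewrite mulf_neq0 ?invr_neq0 ?upper_unitmx_diag.
Qed.

Lemma std_scalar_frame : scalar_frame s es.
Proof.
split.
  rewrite unitv_std_vecs -row_translation0 => /row_translation_inj.
  by move/rowP/(_ ord_max); rewrite !mxE !eqxx => /eqP; rewrite oner_eq0.
split=> [x /coef_stdP[a ->] |].
  by apply/coef_stdP; rewrite -row_translationN -scaleNr; eexists.
split=> [z b /scal_stdP[a [d [a0 d0 ->]]] + /translation_stdP[w ->] |].
  rewrite unitv_std_vecs !row_translation_homothety // => /row_translation_inj.
  by rewrite -[RHS]scale1r => /delta_scale_inj->; rewrite scale1r.
split=> [x y b u v /translation_stdP[w ->] |].
  move=> /scale_stdP[a [-> ->]] /scale_stdP[d [-> ->]].
  by apply/scale_stdP; rewrite -!row_translationD -!scalerDl; eexists.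
split=> [g | x y].
  have [a [v [M [a0 uM ->]]]] := utblockP g.
  rewrite unitv_std_vecs -[delta_mx _ _]scale1r unitv_conj //.
  by apply/coef_stdP; eexists.
(* The characters of [x * y] and [y * x] agree, so that of [~ x, y] is 1. *)
have [k [k0 kE]] := delta_charP x; have [l [l0 lE]] := delta_charP y.
have [r [_ rE]] := delta_charP [~ x, y]%g.
have := congr1 (fun g => tv (1 *: delta) ^ g)%g (commgC x y).
rewrite /= (conjgM _ (y * x)%g) (conjgM _ x) (conjgM _ y) !(kE, lE, rE).
move/row_translation_inj/delta_scale_inj.
rewrite !mulr1 [k * l]mulrC -{1}[l * k]mul1r.
move/(mulIf (mulf_neq0 l0 k0)) => r1.
by rewrite unitv_std_vecs -[delta_mx _ _]scale1r rE -r1 mul1r.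
Qed.

Lemma std_basis_frame : basis_frame s es.
Proof.
split=> [i|].
  rewrite size_std_vecs => lt_im; rewrite (nth_std_vecs (Ordinal lt_im)).
  by apply/translation_stdP; eexists.
split=> [b /translation_stdP[w ->] | i].
  by rewrite -[X in span _ _ X _]drop0; apply/span_drop_stdP => //; exists w.
rewrite size_std_vecs => lt_im; rewrite (nth_std_vecs (Ordinal lt_im)).
move/(span_drop_stdP _ lt_im) => [w [w0 /row_translation_inj wE]].
have := w0 (Ordinal lt_im) (ltnSn i); rewrite -wE mxE !eqxx => /eqP.
by rewrite oner_eq0.
Qed.

Lemma std_flag_frame : flag_frame s es.
Proof.
rewrite /flag_frame size_std_vecs; split=> [i lt_im c cc|].
  rewrite (nth_std_vecs (Ordinal lt_im)).
  have [a [v [M [a0 uM ->]]]] := utblockP c.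
  rewrite row_translationJ // -rowE.
  apply/(span_drop_stdP _ (ltnW lt_im)); eexists; split; last by [].
  have /upper_unitmxP[tM _] := uM.
  by move=> j lt_ji; rewrite !mxE tM ?mulr0.
split=> [bs szbs bsE | c cc esc].
  have rowP (i : 'I_m) : exists w : 'rV[F]_m,
      [/\ nth 1%g bs i = tv w, forall j : 'I_m, (j < i)%N -> w 0 j = 0
        & w 0 i != 0].
    have [+ bN] := bsE i (ltn_ord i).
    move/(span_drop_stdP _ (ltnW (ltn_ord i))) => [w [w0 wE]].
    exists w; split=> //; apply/eqP => wi0; apply: bN.
    apply/span_drop_stdP => //; exists w; split=> // j.
    by rewrite ltnS leq_eqVlt => /orP[/eqP/val_inj-> | /w0].
  pose N : 'M[F]_m := \matrix_i projT1 (cid (rowP i)).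
  have uN : upper_unitmx N.
    apply: upper_unitmxI => [i j lt_ji | i]; rewrite mxE;
      case: cid => w [_ w0 wi] //=; exact: w0.
  exists (utblock 1 0 N); split=> [|i lt_im]; first exact/cent_stdP.
  rewrite (nth_std_vecs (Ordinal lt_im)) row_translationJ // invr1 scale1r.
  rewrite -rowE rowK; case: cid => w [wE _ _] /=.
  exact: esym wE.
have [a [v [M [a0 uM cE]]]] := utblockP c.
rewrite {}cE in cc esc *; move/(cent_stdP v a0 uM): cc => v0.
have -> : M = a%:M.
  apply/row_matrixP => i; have := esc i (ltn_ord i).
  rewrite nth_std_vecs row_translationJ // => /row_translation_inj.
  rewrite -rowE => /(congr1 ( *:%R a)); rewrite scalerA divff // scale1r => ->.
  by apply/rowP => j; rewrite !mxE mulr_natr eqxx [i == j]eq_sym.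
rewrite v0; exact: central_utblock.
Qed.

Lemma std_frame : frame s es.
Proof.
split; first exact: std_translation_frame.
split; first exact: std_scalar_frame.
by split; [exact: std_basis_frame | exact: std_flag_frame].
Qed.

End StandardFrame.

(** * The field of an arbitrary frame of the triangular group *)

(** Here [s] and [es] are any frame, while [t] only provides commutators in the
    triangular group. *)
Section TriangularFrames.
Local Open Scope ring_scope.
Variables (F : fieldType) (m' : nat).
Local Notation m := m'.+1.
Local Notation T := (utriang m.+1 F).
Local Notation tv := (@row_translation F m').
Local Notation delta := (delta_mx 0 (ord_max : 'I_m) : 'rV[F]_m).
Variables (t : F) (t0 : t != 0) (t1 : t != 1).
Variables (s : T) (es : seq T) (good : frame s es).
Local Notation L := (coefs good).

Let nz1 : (1 : F) != 0 := oner_neq0 F.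
Let up1 : upper_unitmx (1%:M : 'M[F]_m) := upper_unitmx1 m F.

(** Conjugation by the diagonal matrix [D] with last entry [t] multiplies the
    root coordinate by [t]; a commutator with [D] thus multiplies it by [t - 1],
    which is invertible. *)
Lemma elementary_commutator (k : 'I_m) : k != ord_max ->
  exists x y, utblock 1 0 (1%:M + delta_mx k ord_max) = [~ x, y]%g :> T.
Proof.
move=> k_neq; have k_neqF := negbTE k_neq.
have lt_k := ltn_ord_max k_neq.
pose N c : 'M[F]_m := 1%:M + c *: delta_mx k ord_max.
pose D : 'M[F]_m := 1%:M + (t - 1) *: delta_mx ord_max ord_max.
have uN c : upper_unitmx (N c) := upper_unitmx_elementary c lt_k.
have uD : upper_unitmx D.
  apply: upper_unitmxI => [i j lt_ji | i]; rewrite !mxE.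
    rewrite [i == j]eq_sym (ord_ltn_eqF lt_ji) add0r.
    have [ik | _] := eqVneq i ord_max; last by rewrite mulr0.
    have [jE | _] := eqVneq j ord_max; last by rewrite mulr0.
    by rewrite ik jE ltnn in lt_ji.
  rewrite eqxx; have [_ | _] := eqVneq i ord_max; last by rewrite mulr0 addr0.
  by rewrite mulr1 addrC subrK.
pose E : 'M[F]_m := delta_mx k ord_max.
have E1 : E *m D = t *: E.
  rewrite mulmxDr mulmx1 -scalemxAr mul_delta_mx_cond eqxx mulr1n.
  by rewrite -/E -{1}[E]scale1r -scalerDl addrC subrK.
have E2 : D *m E = E.
  rewrite /D mulmxDl mul1mx -scalemxAl mul_delta_mx_cond eq_sym k_neqF.
  by rewrite mulr0n scaler0 addr0.
have E3 : E *m E = 0.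
  by rewrite mul_delta_mx_cond eq_sym k_neqF.
pose c := (t - 1)^-1.
exists (utblock 1 0 (N c)), (utblock 1 0 D).
apply: (mulgI (utblock 1 0 D * utblock 1 0 (N c))%g); rewrite -commgC.
have uN1 : upper_unitmx (1%:M + E) by rewrite -[E]scale1r; exact: uN.
rewrite (utblockM 0 0 nz1 (uN c) nz1 uD) (utblockM 0 0 nz1 uD nz1 (uN c)).
rewrite !mulr1 !scale1r !mul0mx !addr0.
rewrite (utblockM 0 0 nz1 (upper_unitmxM uD (uN c)) nz1 uN1).
rewrite !mulr1 !scale1r !mul0mx !addr0; congr (utblock _ _ _).
have -> : N c *m D = D + (c * t) *: E.
  by rewrite /N mulmxDl mul1mx -scalemxAl E1 scalerA.
have -> : D *m N c = D + c *: E by rewrite /N mulmxDr mulmx1 -scalemxAr E2.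
rewrite mulmxDr mulmx1 mulmxDl E2 -scalemxAl E3 scaler0 addr0 -addrA.
rewrite -[X in c *: E + X]scale1r -scalerDl; congr (_ + _ *: _).
have ct : c * (t - 1) = 1 by rewrite mulVf ?subr_eq0.
by rewrite -[X in c + X]ct mulrBr mulr1 addrC subrK.
Qed.

(** As a translation of the frame, [unitv] is a commutator, and it commutes with
    all commutators. Translations by row vectors are commutators, so the linear
    part of [unitv] is scalar, equal to its corner entry, which is 1 for a
    commutator. Commuting with the elementary matrices then leaves no entry in
    its row but the last one. *)
Lemma unitv_utriang : exists u, u != 0 /\ unitv es = tv (u *: delta).
Proof.
have [a [v [M [a0 uM fE]]]] := utblockP (unitv es).
have tvf w : (tv w ^ unitv es)%g = tv w.
  have /(translation_stdP t0 t1)[g wE] : exists w', tv w = tv w' by exists w.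
  apply/conjg_fixP; rewrite commg1_sym; apply/conjg_fixP.
  by rewrite wE; exact: (frame_unitvR good).
have a1 : a = 1.
  have [g gE] := translation_unitv good.
  exact: (commutator_corner a0 uM (etrans (esym fE) gE)).
have M1 : M = 1%:M.
  apply/row_matrixP => i; rewrite row1 rowE.
  have := tvf (delta_mx 0 i); rewrite fE row_translationJ // a1 invr1 scale1r.
  exact: row_translation_inj.
rewrite {}a1 {}M1 -/(tv v) in fE.
have v0 (k : 'I_m) : k != ord_max -> v 0 k = 0.
  move=> k_neq; have [x [y xyE]] := elementary_commutator k_neq.
  have := frame_unitvR good x y.
  rewrite -xyE fE row_translationJ //; last first.
    rewrite -[delta_mx _ _]scale1r; apply: upper_unitmx_elementary.
    exact: ltn_ord_max.
  rewrite invr1 scale1r => /row_translation_inj.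
  rewrite mulmxDr mulmx1 => /rowP/(_ ord_max); rewrite !mxE.
  rewrite (bigD1 k) //= big1 ?addr0 => [|j jk]; last first.
    by rewrite mxE (negbTE jk) mulr0.
  rewrite mxE !eqxx mulr1 => /eqP.
  by rewrite -subr_eq0 addrAC subrr add0r => /eqP.
exists (v 0 ord_max).
have vE : v = v 0 ord_max *: delta.
  apply/rowP => j; rewrite !mxE eqxx /=.
  by have [-> | /v0->] := eqVneq j ord_max; rewrite ?mulr1 ?mulr0.
split; last by rewrite -vE.
apply/eqP => u0; apply: (frame_unitv_neq1 good).
by rewrite fE vE u0 scale0r row_translation0.
Qed.

Lemma unitv_utriangJ g : exists k, k != 0 /\
  forall c, (tv (c *: delta) ^ g)%g = tv ((k * c) *: delta).
Proof. exact: delta_charP. Qed.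

Section Field.
Variables (u : F) (u0 : u != 0) (uE : unitv es = tv (u *: delta)).

(** For [a] nonzero, conjugation by diag(1 / a, 1, ..., 1) multiplies
    [unitv] by [a], so the condition that conjugates of [unitv] are coefficients
    provides all of [F]. *)
Lemma coef_utriang a : coef s es (tv ((a * u) *: delta)).
Proof.
have [-> | a0] := eqVneq a 0.
  by left; rewrite mul0r scale0r row_translation0.
have := frame_unitvJ good (utblock a^-1 0 1%:M).
rewrite uE row_translation_homothety ?invr_neq0 // invrK mulr1.
by rewrite scalerA.
Qed.

Definition utriang_coef a : L := coefs_of good (coef_utriang a).

Lemma utriang_coef_is_additive : zmod_morphism utriang_coef.
Proof.
move=> a b; apply: coefs_inj; rewrite /= mulrBl scalerBl.
by rewrite row_translationD row_translationN.
Qed.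

(** A nonzero coefficient is the conjugate of [unitv] by a scalar [z] of the
    frame, and [z] multiplies the line of [delta] by a constant; this constant
    is the corresponding element of [F]. *)
Lemma utriang_coef_is_multiplicative : monoid_morphism utriang_coef.
Proof.
split; first by apply: coefs_inj; rewrite /= uE mul1r.
move=> a b; apply: coefs_inj => /=; set x := tv ((a * u) *: delta).
have trb := translation_coef good (coef_utriang b).
have [x1 | [z [sz xE]]] := coef_utriang a.
  have au0 : a * u = 0.
    apply: (@delta_scale_inj F m'); apply: row_translation_inj.
    by rewrite scale0r row_translation0.
  rewrite /x x1 smul1g.
  have /eqP := au0; rewrite mulf_eq0 (negbTE u0) orbF => /eqP->.
  by rewrite !mul0r scale0r row_translation0.
rewrite (smulE good trb sz xE); have [k [_ kE]] := unitv_utriangJ z.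
have ak : a = k.
  apply: (mulIf u0); apply: (@delta_scale_inj F m').
  by apply: row_translation_inj; rewrite -kE -uE.
by rewrite kE -ak mulrA.
Qed.

Lemma utriang_coef_bij : bijective utriang_coef.
Proof.
have coefP x : coef s es x -> exists a, x = tv ((a * u) *: delta).
  case=> [-> | [z [_ ->]]].
    by exists 0; rewrite mul0r scale0r row_translation0.
  by have [k [_ kE]] := unitv_utriangJ z; exists k; rewrite uE kE.
have surj (x : L) : exists a, utriang_coef a = x.
  by have [a xE] := coefP _ (coefsP x); exists a; apply: coefs_inj.
exists (fun x => projT1 (cid (surj x))) => [a | x]; last by case: cid.
case: cid => b /= /(congr1 sval)/row_translation_inj/delta_scale_inj.
exact: mulIf.
Qed.

End Field.

Lemma utriang_coefs_isom : exists h : {rmorphism F -> L}, bijective h.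
Proof.
have [u [u0 uE]] := unitv_utriang.
pose hD := GRing.isZmodMorphism.Build F L _ (utriang_coef_is_additive uE).
pose hM := GRing.isMonoidMorphism.Build F L _
  (utriang_coef_is_multiplicative u0 uE).
pose h : {rmorphism F -> L} := HB.pack (utriang_coef uE) hD hM.
by exists h; apply: utriang_coef_bij.
Qed.

End TriangularFrames.

(** * Ring formulas about the field of a frame *)

Section RingIsomorphism.
Local Open Scope ring_scope.
Variables (R S : pzRingType) (h : {rmorphism R -> S}).

Lemma ring_eval_rmorph n (e : n.-tuple R) t :
  ring_eval (map_tuple h e) t = h (ring_eval e t).
Proof.
elim: t => /= [i | | | t -> | t -> u -> | t -> u ->].
- exact: tnth_map.
- by rewrite rmorph0.
- by rewrite rmorph1.
- by rewrite rmorphN.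
- by rewrite rmorphD.
- by rewrite rmorphM.
Qed.

Lemma holds_ring_isom : bijective h -> forall n (phi : formula ring_term n) e,
  holds (@ring_eval R) phi e <-> holds (@ring_eval S) phi (map_tuple h e).
Proof.
move=> h_bij n; have [h' hK h'K] := h_bij.
have consE k x (e : k.-tuple R) :
    map_tuple h [tuple of x :: e] = [tuple of h x :: map_tuple h e].
  exact: val_inj.
elim=> {n} [n t u | n p IHp | n p IHp q IHq | n p IHp q IHq | n p IHp q IHq
  | n p IHp | n p IHp] e /=.
- rewrite !ring_eval_rmorph; split=> [-> // |]; exact: (can_inj hK).
- exact/not_iff/IHp.
- by apply: and_iff; [apply: IHp | apply: IHq].
- by apply: or_iff; [apply: IHp | apply: IHq].
- by apply: imp_iff; [apply: IHp | apply: IHq].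
- split=> H x; last by apply/IHp; rewrite consE; apply: H.
  by rewrite -(h'K x) -consE; apply/IHp/H.
split=> -[x Hx]; first by exists (h x); rewrite -consE; apply/IHp.
by exists (h' x); apply/IHp; rewrite consE h'K.
Qed.

Lemma isom_ring_elem_equiv : bijective h -> ring_elem_equiv R S.
Proof.
move=> h_bij phi; apply: (iff_trans (holds_ring_isom h_bij phi _)).
by rewrite (_ : map_tuple _ _ = [tuple]) //; apply: val_inj.
Qed.

End RingIsomorphism.

Section Interpretation.

Definition lift_vars k q (r : 'I_k -> group_term q) i := term_lift (r i).

Definition cons_vars k q (r : 'I_k -> group_term q) (i : 'I_k.+1) :=
  if unlift ord0 i is Some j then term_lift (r j) else var0 q.

(** The value of a ring term cannot be given by a group term, the product of the
    field being only a definable relation: hence the argument [x], for this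
    value. *)
Fixpoint ring_termf k (t : ring_term k) q (r : 'I_k -> group_term q)
    (s : group_term q) es x : formula group_term q :=
  let r1 := lift_vars r in let r2 := lift_vars r1 in
  let s1 := term_lift s in let s2 := term_lift s1 in
  let es1 := seq_lift es in let es2 := seq_lift es1 in
  let x1 := term_lift x in let x2 := term_lift x1 in
  match t with
  | RVar i => Equal x (r i)
  | RZero => Equal x (GOne q)
  | ROne => Equal x (last (GOne q) es)
  | ROpp t => Exists (ring_termf t r1 s1 es1 (var0 q) &&&
                      Equal x1 (GInv (var0 q)))
  | RAdd t u => Exists (Exists (ring_termf t r2 s2 es2 (var1 q) &&&
                  ring_termf u r2 s2 es2 (var0 q.+1) &&&
                  Equal x2 (GMul (var1 q) (var0 q.+1))))
  | RMul t u => Exists (Exists (ring_termf t r2 s2 es2 (var1 q) &&&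
                  ring_termf u r2 s2 es2 (var0 q.+1) &&&
                  scalef s2 es2 (var1 q) (var0 q.+1) x2))
  end.

(** Ring variables range over the coefficients, so quantifiers are relativized
    to [coeff]. *)
Fixpoint ring_formulaf k (phi : formula ring_term k) {struct phi} :
    forall q, ('I_k -> group_term q) -> group_term q -> seq (group_term q) ->
    formula group_term q :=
  match phi with
  | Equal _ t u => fun q r s es =>
      let r1 := lift_vars r in
      let s1 := term_lift s in let es1 := seq_lift es in
      Exists (ring_termf t r1 s1 es1 (var0 q) &&&
              ring_termf u r1 s1 es1 (var0 q))
  | Not _ p => fun q r s es => Not (ring_formulaf p r s es)
  | And _ p p' => fun q r s es =>
      ring_formulaf p r s es &&& ring_formulaf p' r s es
  | Or _ p p' => fun q r s es =>
      Or (ring_formulaf p r s es) (ring_formulaf p' r s es)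
  | Defs.Implies _ p p' => fun q r s es =>
      ring_formulaf p r s es ==> ring_formulaf p' r s es
  | Forall _ p => fun q r s es =>
      Forall (coeff (term_lift s) (seq_lift es) (var0 q) ==>
              ring_formulaf p (cons_vars r) (term_lift s) (seq_lift es))
  | Exists _ p => fun q r s es =>
      Exists (coeff (term_lift s) (seq_lift es) (var0 q) &&&
              ring_formulaf p (cons_vars r) (term_lift s) (seq_lift es))
  end.

Variables (G : groupType) (s : G) (es : seq G) (good : frame s es).
Local Notation L := (coefs good).

(** Under [E], the terms [st] and [est] denote the frame, and the terms [r i]
    denote the elements of the valuation [e] in its field. *)
Definition reads q (E : q.-tuple G) k (r : 'I_k -> group_term q) st est
    (e : k.-tuple L) : Prop :=
  [/\ group_eval E st = s, [seq group_eval E v | v <- est] = es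
    & forall i, group_eval E (r i) = sval (tnth e i)].

Lemma reads_lift q (E : q.-tuple G) k (r : 'I_k -> group_term q) st est e y :
  reads E r st est e ->
  reads [tuple of y :: E] (lift_vars r) (term_lift st) (seq_lift est) e.
Proof.
by case=> sE esE rE; split=> [||i]; rewrite ?eval_seq_lift // eval_lift.
Qed.

Lemma reads_cons q (E : q.-tuple G) k (r : 'I_k -> group_term q) st est e a :
  reads E r st est e ->
  reads [tuple of sval a :: E] (cons_vars r) (term_lift st) (seq_lift est)
    [tuple of a :: e].
Proof.
case=> sE esE rE; split=> [||i]; rewrite ?eval_seq_lift ?eval_lift //.
rewrite /cons_vars; case: unliftP => [j ->|->]; last by rewrite tnth0.
by rewrite tnthS eval_lift.
Qed.

Lemma reads_coeff q (E : q.-tuple G) k (r : 'I_k -> group_term q) st est e y :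
    reads E r st est e ->
  holds (@group_eval G) (coeff (term_lift st) (seq_lift est) (var0 q))
    [tuple of y :: E] <-> coef s es y.
Proof.
move/(reads_lift y) => [sE esE _].
by apply: (iff_trans (holds_coeff _ _ _ _)); rewrite sE esE.
Qed.

Lemma exists_eq_and (T : Type) (a : T) (P Q : T -> Prop) :
  (forall y, P y <-> y = a) -> (exists y, P y /\ Q y) <-> Q a.
Proof.
move=> PE; split=> [[y [/PE->]] // | Qa].
by exists a; split=> //; apply/PE.
Qed.

Lemma holds_ring_termf k (e : k.-tuple L) t q (E : q.-tuple G) r st est x :
    reads E r st est e ->
  holds (@group_eval G) (ring_termf t r st est x) E <->
  group_eval E x = sval (ring_eval e t).
Proof.
have coefPe u := coefsP (ring_eval e u).
elim: t q E r st est x => [i | | | t IHt | t IHt u IHu | t IHt u IHu]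
  q E r st est x Ee.
- by case: Ee => _ _ rE; rewrite /= rE.
- by [].
- by case: Ee => _ esE _; rewrite /= eval_last esE.
- rewrite /=.
  apply: (iff_trans (exists_eq_and _ (a := sval (ring_eval e t)) _)) => [y|].
    by apply: IHt; apply: reads_lift.
  by rewrite eval_lift.
- rewrite /=; pose a := sval (ring_eval e t); pose b := sval (ring_eval e u).
  apply: (iff_trans (B := exists y z,
    y = a /\ (z = b /\ group_eval E x = (y * z)%g))).
    apply: exists_iff => y; apply: exists_iff => z; apply: and_iff.
      apply: (iff_trans (IHt _ _ _ _ _ _ (reads_lift z (reads_lift y Ee)))).
      by rewrite /= tnthS.
    apply: and_iff; first exact: IHu (reads_lift z (reads_lift y Ee)).
    by rewrite !eval_lift tnthS.
  by split=> [[y [z [-> [-> ->]]]] | xE] //; exists a, b.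
pose a := sval (ring_eval e t); pose b := sval (ring_eval e u).
have trb : translation s b by exact/(translation_coef good)/coefPe.
pose s2 := term_lift (term_lift st); pose es2 := seq_lift (seq_lift est).
pose r2 := lift_vars (lift_vars r); pose x2 := term_lift (term_lift x).
rewrite -[X in X <-> _]/(exists y z,
  let E2 := [tuple of z :: [tuple of y :: E]] in
  holds (@group_eval G) (ring_termf t r2 s2 es2 (var1 q)) E2 /\
  (holds (@group_eval G) (ring_termf u r2 s2 es2 (var0 q.+1)) E2 /\
   holds (@group_eval G) (scalef s2 es2 (var1 q) (var0 q.+1) x2) E2)).
apply: (iff_trans (B := exists y z,
  y = a /\ (z = b /\ group_eval E x = smul s es y z))).
  apply: exists_iff => y; apply: exists_iff => z.
  have Ee2 := reads_lift z (reads_lift y Ee).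
  split=> [[/(IHt _ _ _ _ _ _ Ee2) ya [/(IHu _ _ _ _ _ _ Ee2) zb]] | ].
    move/holds_scalef.
    have {}zb : z = b := zb; have {}ya : y = a by rewrite -[a]ya /= tnthS.
    case: Ee2 => -> -> _; rewrite /= tnthS tnth0 !eval_lift ya zb.
    by case/(scaleP good _ _ trb) => _ ->.
  case=> ya [zb xE]; split; last split.
  + by apply/(IHt _ _ _ _ _ _ Ee2); rewrite /= tnthS.
  + by apply/(IHu _ _ _ _ _ _ Ee2).
  apply/holds_scalef; case: Ee2 => -> -> _; rewrite /= tnthS tnth0 !eval_lift.
  by rewrite xE ya zb; apply/(scaleP good _ _ trb); split=> //; exact: coefPe.
by split=> [[y [z [-> [-> ->]]]] | xE] //; exists a, b.
Qed.

Lemma holds_ring_formulaf k (phi : formula ring_term k) (e : k.-tuple L)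
    q (E : q.-tuple G) r st est :
    reads E r st est e ->
  holds (@group_eval G) (ring_formulaf phi r st est) E <->
  holds (@ring_eval L) phi e.
Proof.
elim: phi e q E r st est => {k} [k t u | k p IHp | k p IHp p' IHp'
  | k p IHp p' IHp' | k p IHp p' IHp' | k p IHp | k p IHp] e q E r st est Ee.
- rewrite /=.
  apply: (iff_trans (exists_eq_and _ (a := sval (ring_eval e t)) _)).
    by move=> y; exact: (holds_ring_termf t _ (reads_lift y Ee)).
  apply: (iff_trans (holds_ring_termf u _ (reads_lift _ Ee))).
  by split=> [/coefs_inj | -> ].
- exact/not_iff/IHp.
- by apply: and_iff; [apply: IHp | apply: IHp'].
- by apply: or_iff; [apply: IHp | apply: IHp'].
- by apply: imp_iff; [apply: IHp | apply: IHp'].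
- pose c := coeff (term_lift st) (seq_lift est) (var0 q).
  pose p' := ring_formulaf p (cons_vars r) (term_lift st) (seq_lift est).
  rewrite -[X in X <-> _]/(forall y,
    holds (@group_eval G) c [tuple of y :: E] ->
    holds (@group_eval G) p' [tuple of y :: E]).
  split=> [H a | H y /(reads_coeff _ Ee) cy].
    apply/(IHp _ _ _ _ _ _ (reads_cons a Ee))/H.
    exact/(reads_coeff _ Ee)/coefsP.
  exact/(IHp _ _ _ _ _ _ (reads_cons (coefs_of good cy) Ee))/H.
pose c := coeff (term_lift st) (seq_lift est) (var0 q).
pose p' := ring_formulaf p (cons_vars r) (term_lift st) (seq_lift est).
rewrite -[X in X <-> _]/(exists y, holds (@group_eval G) c [tuple of y :: E] /\
  holds (@group_eval G) p' [tuple of y :: E]).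
split=> [[y [/(reads_coeff _ Ee) cy Hy]] | [a Ha]].
  exists (coefs_of good cy).
  exact/(IHp _ _ _ _ _ _ (reads_cons (coefs_of good cy) Ee)).
exists (sval a); split; last exact/(IHp _ _ _ _ _ _ (reads_cons a Ee)).
exact/(reads_coeff _ Ee)/coefsP.
Qed.

End Interpretation.

(** * Transfer *)

Section FrameSentences.
Variable m : nat.
Implicit Types (G : groupType) (phi : formula ring_term 0).

Definition frame_vars : seq (group_term (m.+1 + 0)) :=
  [seq block_var 0 i | i <- enum 'I_m.+1].
Definition frame_base := head (GOne (m.+1 + 0)) frame_vars.
Definition frame_vecs := behead frame_vars.

Lemma eval_frame_vars G (xs : m.+1.-tuple G) :
  group_eval [tuple of xs ++ [tuple]] frame_base = thead xs /\
  [seq group_eval [tuple of xs ++ [tuple]] v | v <- frame_vecs] = behead xs.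
Proof.
have E : [seq group_eval [tuple of xs ++ [tuple]] v | v <- frame_vars] = xs.
  exact: eval_block_seq.
split; last by rewrite -[in RHS]E behead_map.
rewrite (tuple_eta xs) in E *; move: E.
by rewrite /frame_base; case: frame_vars => //= v vs [].
Qed.

Lemma forall_cons_tuple G (Q : G -> seq G -> Prop) :
  (forall xs : m.+1.-tuple G, Q (thead xs) (behead xs)) <->
  (forall s es, size es = m -> Q s es).
Proof.
split=> [H s es /eqP szes | H xs]; first exact: (H [tuple of s :: Tuple szes]).
by apply: H; rewrite size_behead size_tuple.
Qed.

Definition no_frame_sentence : formula group_term 0 :=
  foralls (Not (framef frame_base frame_vecs)).

Lemma holds_no_frame_sentence G :
  holds (@group_eval G) no_frame_sentence [tuple] <->
  forall (s : G) es, size es = m -> ~ frame s es.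
Proof.
apply: (iff_trans (holds_foralls _ _)); rewrite -forall_cons_tuple.
apply: forall_iff => xs; have [sE esE] := eval_frame_vars xs.
apply: not_iff; apply: (iff_trans (holds_framef _ _ _)).
by rewrite sE esE.
Qed.

Definition coefs_sentence phi : formula group_term 0 :=
  foralls (framef frame_base frame_vecs ==>
    ring_formulaf phi (fun=> GOne _) frame_base frame_vecs).

Lemma holds_coefs_sentence G phi :
  holds (@group_eval G) (coefs_sentence phi) [tuple] <->
  forall (s : G) es, size es = m ->
    forall good : frame s es, holds (@ring_eval (coefs good)) phi [tuple].
Proof.
apply: (iff_trans (holds_foralls _ _)).
rewrite -(forall_cons_tuple (fun s es => forall good : frame s es,
  holds (@ring_eval (coefs good)) phi [tuple])).
apply: forall_iff => xs; have [sE esE] := eval_frame_vars xs.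
set E := [tuple of xs ++ [tuple]] in sE esE *.
have phiE (good : frame (thead xs) (behead xs)) :
    holds (@group_eval G)
      (ring_formulaf phi (fun=> GOne _) frame_base frame_vecs) E <->
    holds (@ring_eval (coefs good)) phi [tuple].
  by apply: holds_ring_formulaf; split=> // -[].
have frameE : holds (@group_eval G) (framef frame_base frame_vecs) E <->
    frame (thead xs) (behead xs).
  by apply: (iff_trans (holds_framef _ _ _)); rewrite sE esE.
by split=> [H good | H /frameE good]; [apply/phiE/H/frameE | apply/(phiE good)].
Qed.

End FrameSentences.

Lemma infinite_field_neq01 (F : fieldType) :
  infinite_set [set: F] -> exists2 t : F, t != 0%R & t != 1%R.
Proof.
move=> infF; apply: contrapT => no_t; apply: infF.
apply: (sub_finite_set _ (finite_set2 (0%R : F) 1%R)) => t _ /=.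
have [-> | t0] := eqVneq t 0%R; first by left.
by have [-> | t1] := eqVneq t 1%R; [right | case: no_t; exists t].
Qed.

Theorem corollary5p4 (n : nat) (F : fieldType) (H : groupType) :
  (3 <= n)%N ->
  infinite_set [set: F] ->
  2%N \notin [pchar F]%R ->
  group_elem_equiv H (utriang n F) ->
  exists L : fieldType,
    ring_elem_equiv L F /\
    isomorphic (central_quotient H) (putriang n L).
Proof.
move=> n_ge3 infF _ HF; have [t t0 t1] := infinite_field_neq01 infF.
case: n n_ge3 HF => [|[|m]] // _ HF.
(* [H] has a frame, since T_n(F) has one. *)
have [s [es [szes good]]] : exists (s : H) es, size es = m.+1 /\ frame s es.
  apply: contrapT => noH.
  have /HF/holds_no_frame_sentence noF :
      holds (@group_eval H) (no_frame_sentence m.+1) [tuple].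
    apply/holds_no_frame_sentence => s es szes good.
    by apply: noH; exists s, es.
  exact: (noF _ _ (size_std_vecs F m) (std_frame m t0 t1)).
exists (coefs good); split; last first.
  by have := frame_isomorphic good; rewrite szes.
(* The converse implication is obtained by applying [transfer] to negations. *)
have transfer phi : holds (@ring_eval F) phi [tuple] ->
    holds (@ring_eval (coefs good)) phi [tuple].
  move=> Fphi; have /HF/holds_coefs_sentence : holds
      (@group_eval (utriang m.+2 F)) (coefs_sentence m.+1 phi) [tuple].
    apply/holds_coefs_sentence => s' es' _ good'.
    have [h h_bij] := utriang_coefs_isom t0 t1 good'.
    exact/(isom_ring_elem_equiv h_bij).
  exact.
move=> phi; split=> [Lphi |]; last exact: transfer.
by apply: contrapT => /(transfer (Not phi)).
Qed.
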